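(* Let $\{B_0,B_1\}$ be an irreducible pair of nonsingular affine contractions of $\mathbb R^d$ satisfying the Barnsley condition, let $v:[0,1]\to\mathbb R^d$ be the fractal curve generated by them, and let $\tilde B_0,\tilde B_1$ be the matrices of the linear parts of $B_0,B_1$. The curve $v$ has constant local regularity (the local Hölder exponent $\alpha_v(t)$ is the same at all points $t\in[0,1]$) if and only if there is a basis of $\mathbb R^d$ in which both $\tilde B_0,\tilde B_1$ have the block upper triangular form $$\tilde B_k=\begin{pmatrix}\tilde B_k^{(1)} & * & \cdots & *\\ 0 & \tilde B_k^{(2)} & * & \vdots\\ \vdots & & \ddots & *\\ 0&\cdots&0&\tilde B_k^{(s)}\end{pmatrix},\qquad k=0,1,$$ with square diagonal blocks of the same sizes and locations for $k=0,1$ and with each pair $\{\tilde B_0^{(i)},\tilde B_1^{(i)}\}$ irreducible, where in one diagonal block, say the $j$-th, both matrices $\tilde B_0^{(j)}$ and $\tilde B_1^{(j)}$ are orthogonal matrices multiplied by a number $r\in[\frac12,1)$, and in the other blocks $\rho(\tilde B_0^{(i)},\tilde B_1^{(i)})\le r$, $i\neq j$. In this case $\alpha_v(t)=-\log_2 r$ at all points $t\in[0,1]$.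
   Context: $B_0,B_1:\mathbb R^d\to\mathbb R^d$ are affine contractions (with respect to a common norm on $\mathbb R^d$); the pair is irreducible if $B_0,B_1$ do not share a common proper affine invariant plane (of any dimension from $0$ to $d-1$). An affine operator is nonsingular if its linear part is. Let $v_i$ be the unique fixed point of $B_i$, $i=0,1$. The Barnsley condition (cross-condition) is $B_0v_1=B_1v_0$. Under these conditions the functional equation $v(t)=B_0v(2t)$ for $t\in[0,\frac12]$, $v(t)=B_1v(2t-1)$ for $t\in[\frac12,1]$ has a unique continuous solution $v:[0,1]\to\mathbb R^d$, called the fractal curve. The local Hölder exponent at $t\in[0,1]$ is $\alpha_v(t)=\sup\{\alpha>0 : |v(t+h)-v(t)|\le C|h|^{\alpha}\}$, where $C$ is a constant independent of $h$ and $h$ ranges over values with $t+h\in[0,1]$. A pair of square matrices is irreducible if they have no common invariant linear subspace other than $\{0\}$ and the whole space. $\rho(M_0,M_1)=\lim_{k\to\infty}\max_{d_1,\dots,d_k\in\{0,1\}}\|M_{d_k}\cdots M_{d_1}\|^{1/k}$ is the joint spectral radius of a pair of matrices. *)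

(* Defs.v *)
From HB Require Import structures.
From mathcomp Require Export all_boot all_order all_algebra.
From mathcomp Require Export all_classical all_reals all_analysis.

Set Implicit Arguments.
Unset Strict Implicit.
Unset Printing Implicit Defensive.

Export Order.TTheory GRing.Theory Num.Theory.
Export numFieldNormedType.Exports.

Local Open Scope classical_set_scope.
Local Open Scope ring_scope.

(* Points of R^d are column vectors 'cV[R]_d.  A pair indexed by {0, 1}
   is a family over bool, with false standing for 0 and true for 1. *)

Record affine_op (R : realType) (d : nat) := AffineOp {
  linear_part : 'M[R]_d ;
  shift_part : 'cV[R]_d }.

Definition affine_apply (R : realType) (d : nat) (B : affine_op R d)
    (x : 'cV[R]_d) : 'cV[R]_d :=
  linear_part B *m x + shift_part B.

Coercion affine_apply : affine_op >-> Funclass.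

Definition is_norm (R : realType) (d : nat) (N : 'cV[R]_d -> R) : Prop :=
  [/\ forall x y, N (x + y) <= N x + N y,
      forall (a : R) x, N (a *: x) = `|a| * N x &
      forall x, N x = 0 -> x = 0].

Definition common_contractions (R : realType) (d : nat)
    (B : bool -> affine_op R d) : Prop :=
  exists N : 'cV[R]_d -> R, is_norm N /\
    forall k, exists2 q : R, 0 <= q < 1 &
      forall x y, N (B k x - B k y) <= q * N (x - y).

Definition nonsingular (R : realType) (d : nat) (B : affine_op R d) : Prop :=
  linear_part B \in unitmx.

(* A proper affine plane is p + U, with U a linear subspace of dimension
   at most d - 1 (U = 0 gives the points). *)
Definition affine_irreducible (R : realType) (d : nat)
    (B : bool -> affine_op R d) : Prop :=
  ~ exists (p : 'cV[R]_d) (U : {vspace 'cV[R]_d}),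
      (\dim U < d)%N /\
      forall k (x : 'cV[R]_d), x - p \in U -> B k x - p \in U.

(* v0 and v1 are unique as soon as B false and B true are contractions. *)
Definition barnsley (R : realType) (d : nat) (B : bool -> affine_op R d) :
    Prop :=
  exists v0 v1 : 'cV[R]_d,
    [/\ B false v0 = v0, B true v1 = v1 & B false v1 = B true v0].

(* Only the values of v on [0, 1] are constrained. *)
Definition fractal_curve (R : realType) (d : nat)
    (B : bool -> affine_op R d) (v : R -> 'cV[R]_d) : Prop :=
  [/\ {within `[0, 1], continuous v},
      forall t : R, 0 <= t <= 2^-1 -> v t = B false (v (2 * t)) &
      forall t : R, 2^-1 <= t <= 1 -> v t = B true (v (2 * t - 1))].

(* The supremum is taken in the extended reals.  `|_| on R^d is the max norm;
   replacing it by another norm only changes the constant C. *)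
Definition holder_exponent (R : realType) (d : nat) (v : R -> 'cV[R]_d)
    (t : R) : \bar R :=
  ereal_sup [set a%:E | a in [set a : R | 0 < a /\
    exists C : R, forall h : R, 0 <= t + h <= 1 ->
      `|v (t + h) - v t| <= C * `|h| `^ a]].

Definition constant_local_regularity (R : realType) (d : nat)
    (v : R -> 'cV[R]_d) : Prop :=
  forall t s : R, 0 <= t <= 1 -> 0 <= s <= 1 ->
    holder_exponent v t = holder_exponent v s.

Definition mx_irreducible_pair (R : realType) (m : nat)
    (M : bool -> 'M[R]_m) : Prop :=
  forall U : {vspace 'cV[R]_m},
    (forall k (x : 'cV[R]_m), x \in U -> M k *m x \in U) ->
    U = 0%VS \/ U = fullv.

(* For w = [:: d_1; ...; d_k] this is M_(d_k) *m ... *m M_(d_1). *)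
Definition word_mx (R : realType) (m : nat) (M : bool -> 'M[R]_m)
    (w : seq bool) : 'M[R]_m :=
  foldl (fun P b => M b *m P) 1%:M w.

(* `|_| on matrices is the largest absolute value of an entry; the limit exists
   and is the same for every norm on the space of matrices. *)
Definition joint_spectral_radius (R : realType) (m : nat)
    (M : bool -> 'M[R]_m) : R :=
  lim ((fun k : nat => (\big[Num.max/0]_(w : k.-tuple bool) `|word_mx M w|)
                         `^ (k%:R^-1)) @ \oo).

Definition orthogonal_mx (R : realType) (m : nat) (U : 'M[R]_m) : Prop :=
  U^T *m U = 1%:M.

(* The columns of P are the new basis of R^d and Q is the inverse of P; the
   type of P already carries the splitting of the dimension into block sizes,
   \sum_i p i = d being a consequence of the invertibility. *)
Definition block_form (R : realType) (d : nat) (M : bool -> 'M[R]_d) (r : R) :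
    Prop :=
  exists (s : nat) (p : 'I_s -> nat)
         (P : 'M[R]_(d, \sum_(i < s) p i)) (Q : 'M[R]_(\sum_(i < s) p i, d)),
    let blk (k : bool) (i j : 'I_s) : 'M[R]_(p i, p j) :=
      submxblock (Q *m M k *m P) i j in
    [/\ P *m Q = 1%:M /\ Q *m P = 1%:M,
        forall i, (0 < p i)%N,
        forall k (i j : 'I_s), (j < i)%N -> blk k i j = 0,
        forall i, mx_irreducible_pair (fun k => blk k i i) &
        exists j : 'I_s,
          (forall k, exists2 U : 'M[R]_(p j),
             orthogonal_mx U & blk k j j = r *: U) /\
          (forall i, i != j -> joint_spectral_radius (fun k => blk k i i) <= r)].

(* Main.v *)
(* Write A_0, A_1 for the linear parts of B_0, B_1.  On the dyadic interval with
   digits d_1 ... d_k the curve is the image of the whole curve under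
   B_{d_1} ... B_{d_k}, and the differences v(s) - v(0) span R^d by
   irreducibility, so the oscillation of v there is comparable to
   |A_{d_1} ... A_{d_k}|.  Regularity is therefore growth of matrix products.

   Given the block form, all products of length k have norm at most C q^k for
   every q > r, and at least c r^k because of the orthogonal block; hence the
   exponent is -log_2 r everywhere.

   Conversely, let the exponent be alpha everywhere and r = 2^(-alpha).
   Products along each infinite word grow at rate at most r; by Koenig's lemma
   this is uniform.  At the fixed point of B_{d_1} ... B_{d_k} the exponent would
   exceed alpha if A_{d_1} ... A_{d_k} had spectral radius below r^k, so no
   product has.  Take a composition series and divide by r: the blocks become
   irreducible pairs with bounded products.  If in each block the mean of |A_w|^2
   over the words w of length n tends to 0, then some word is small in all blocks
   at once, which is excluded.  Otherwise some block carries a quadratic form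
   preserved in the mean.  In Euclidean coordinates for this form, consider the
   set Z of vectors whose norm is preserved up to a constant by all products.  It
   is nonempty, compact, spanning, mapped into itself, and cut out by quadratic
   equations.  Quadratic forms vanishing on Z are a finite-dimensional space on
   which A_k acts injectively, so A_k^(-1) preserves Z too; the inverse products
   are then bounded, and strict convexity of the Frobenius norm forces
   A_0^T A_0 = A_1^T A_1 = 1. *)

Require Import Defs.
From mathcomp Require Import ring lra zify.

Set Implicit Arguments.
Unset Strict Implicit.
Unset Printing Implicit Defensive.

Local Open Scope classical_set_scope.
Local Open Scope ring_scope.

(** * Matrix norms and products along words *)

Section MatrixNorm.
Variable R : realType.

Lemma mx_norm_entry m n (A : 'M[R]_(m, n)) i j : `|A i j| <= `|A|.
Proof.
by rewrite [leRHS]/Num.norm /= mx_normrE; apply/bigmax_geP; right; exists (i, j).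
Qed.

Lemma mx_norm_leP m n (A : 'M[R]_(m, n)) (C : R) :
  0 <= C -> (forall i j, `|A i j| <= C) -> `|A| <= C.
Proof.
move=> C0 AC; rewrite [leLHS]/Num.norm /= mx_normrE.
by apply/bigmax_leP; split => // -[i j] _; exact: AC.
Qed.

Lemma mx_normM m n k (A : 'M[R]_(m, n)) (B : 'M[R]_(n, k)) :
  `|A *m B| <= n%:R * `|A| * `|B|.
Proof.
apply: mx_norm_leP => [|i j]; first by rewrite !mulr_ge0.
rewrite mxE (le_trans (ler_norm_sum _ _ _))//.
apply: (@le_trans _ _ (\sum_(l < n) `|A| * `|B|)).
  by apply: ler_sum => l _; rewrite normrM ler_pM// mx_norm_entry.
by rewrite sumr_const card_ord -[leLHS]mulr_natl mulrA.
Qed.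

(** Uniform boundedness in finite dimension: bounds at the basis vectors bound the columns. *)
Lemma mx_norm_bounded_pointwise (I : Type) m n (F : I -> 'M[R]_(m, n)) :
  (forall x : 'cV[R]_n, exists C, forall i, `|F i *m x| <= C) ->
  exists2 C, 0 <= C & forall i, `|F i| <= C.
Proof.
move=> Fb; have [C CP] := choice (fun j => Fb (delta_mx j 0)).
exists (\sum_j `|C j|) => [|i]; first exact: sumr_ge0.
apply: mx_norm_leP => [|k j]; first exact: sumr_ge0.
have -> : F i k j = (F i *m delta_mx j (0 : 'I_1)) k 0.
  by rewrite -colE mxE.
apply: le_trans (mx_norm_entry _ _ _) _.
apply: le_trans (CP j i) _; apply: le_trans (ler_norm _) _.
by rewrite (bigD1 j)//= lerDl sumr_ge0.
Qed.

(** Bolzano-Weierstrass: the flattening [mxvec] preserves the max norm and reduces to a compact ball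
    of row vectors. *)
Lemma mx_cluster m n (X : nat -> 'M[R]_(m, n)) (C : R) :
  (forall k, `|X k| <= C) ->
  exists Y, forall e : R, 0 < e -> forall N, exists2 k, (N <= k)%N & `|X k - Y| <= e.
Proof.
move=> XC; have mxvec_norm (A : 'M[R]_(m, n)) : `|mxvec A| = `|A|.
  apply/eqP; rewrite eq_le; apply/andP; split; apply: mx_norm_leP => // i j.
    by case/mxvec_indexP: j => k l; rewrite ord1 mxvecE mx_norm_entry.
  by rewrite -mxvecE mx_norm_entry.
pose A := [set v : 'rV[R]_(m * n) | `|v| <= C].
have Ac : compact A.
  apply: bounded_closed_compact.
    by exists C; split; rewrite ?num_real// => M CM v /= vC; apply: le_trans vC (ltW CM).
  rewrite (_ : A = (fun v => `|v|) @^-1` [set x | x <= C])//.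
  apply: closed_comp => [v _|]; first exact: norm_continuous.
  exact: closed_le.
have [] := Ac ((fun k => mxvec (X k)) @ \oo) _.
  by exists 0%N => // k _; rewrite /= /A /= mxvec_norm.
move=> y [_ yX]; exists (vec_mx y) => e e0 N.
have [||z [[k] Nk <-]] := yX [set mxvec (X k) | k in [set k | (N <= k)%N]] (ball y e).
- by exists N => // k /= Nk; exists k.
- exact: nbhsx_ballx.
rewrite -ball_normE /= => /ltW ye; exists k => //.
by rewrite -mxvec_norm linearB /= vec_mxK distrC.
Qed.

End MatrixNorm.

(** * Subspaces given by predicates, and stable subspaces *)

Section LinearAlgebra.

(** Among the subspaces contained in [S], one of maximal dimension is all of [S], since a missing
    vector would enlarge it. *)
Lemma subspace_vspace (F : fieldType) (V : vectType F) (S : V -> Prop) :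
  S 0 -> (forall a x y, S x -> S y -> S (a *: x + y)) ->
  exists U : {vspace V}, forall x, x \in U <-> S x.
Proof.
move=> S0 SD.
pose P n := `[< exists2 U : {vspace V}, \dim U = n & forall x, x \in U -> S x >].
have exP : exists n, P n.
  by exists 0%N; apply/asboolP; exists 0%VS; rewrite ?dimv0// => x /[!memv0] /eqP->.
have ubP n : P n -> (n <= \dim {:V})%N.
  by move=> /asboolP[U <- _]; apply: dimvS; exact: subvf.
case: (ex_maxnP exP ubP) => n /asboolP[U Un US] nmax.
exists U => x; split; first exact: US.
move=> Sx; apply: contrapT => /negP xU.
have : (\dim (U + <[x]>) <= n)%N.
  apply: nmax; apply/asboolP; exists (U + <[x]>)%VS => // _ /memv_addP[u uU [_ /vlineP[k ->] ->]].
  by rewrite addrC; apply: SD => //; exact: US.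
rewrite dimv_disjoint_sum ?dim_vline ?Un; last first.
  apply/eqP; rewrite -subv0; apply/subvP => y /memv_capP[yU /vlineP[k yE]].
  rewrite memv0; have [k0|k0] := eqVneq k 0; first by rewrite yE k0 scale0r.
  move: xU; rewrite -[x](scalerK k0) -yE => /negP; case.
  exact: memvZ.
have -> : x != 0 by apply: contra xU => /eqP->; exact: mem0v.
by rewrite addn1 ltnn.
Qed.

(** By injectivity the image of [U] has the dimension of [U], so [f] maps [U] onto itself. *)
Lemma stable_vspace_inj (F : fieldType) (V : vectType F) (f : 'End(V)) (U : {vspace V}) :
  injective f -> (forall x, x \in U -> f x \in U) ->
  forall x, f x \in U -> x \in U.
Proof.
move=> fI fU x fxU.
have k0 : lker f == 0%VS by apply/lker0P.
have sfU : (f @: U <= U)%VS by apply/subvP => _ /memv_imgP[u uU ->]; exact: fU.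
have : (f @: U)%VS = U.
  apply/eqP; rewrite eqEdim sfU limg_dim_eq ?leqnn//.
  by rewrite (eqP k0) capv0.
by move=> fUU; move: fxU; rewrite -{1}fUU => /memv_imgP[u uU /fI ->].
Qed.

End LinearAlgebra.

Section Words.
Variables (R : realType) (m : nat) (M : bool -> 'M[R]_m).

(** The first letter is the leftmost factor, unlike in [word_mx]: this is the order in which the
    maps of a dyadic address are composed. *)
Definition wprod (w : seq bool) : 'M[R]_m := foldr (fun b P => M b *m P) 1%:M w.

Lemma wprod_cat u w : wprod (u ++ w) = wprod u *m wprod w.
Proof. by elim: u => [|b u IH] /=; rewrite ?mul1mx// IH mulmxA. Qed.

Lemma wprod_rcons w b : wprod (rcons w b) = wprod w *m M b.
Proof. by rewrite -cats1 wprod_cat /= mulmx1. Qed.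

Lemma word_mxE w : word_mx M w = wprod (rev w).
Proof.
elim/last_ind: w => [//|w b IH].
by rewrite /word_mx foldl_rcons -/(word_mx M w) IH rev_rcons.
Qed.

Definition growth (q : R) := exists C : R, forall w, `|wprod w| <= C * q ^+ size w.

End Words.

(** * Averages over words and quadratic forms *)

Lemma expr_small (R : realType) (a e : R) : 0 <= a < 1 -> 0 < e ->
  exists N, forall n, (N <= n)%N -> a ^+ n <= e.
Proof.
move=> /andP[a0 a1] e0.
have /cvgrPdist_le/(_ e e0)[N _ NP] : (fun n => a ^+ n) @ \oo --> (0 : R).
  by apply: cvg_expr; rewrite ger0_norm.
by exists N => n /NP /=; rewrite sub0r normrN ger0_norm// exprn_ge0.
Qed.

Section WordAverage.
Variables (R : realType).

(** Splitting the mean over the [2^n] words by the last letter, that is, by the matrix applied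
    first, makes one step of the recursion a step of the operator
    [M |-> (A_0^T M A_0 + A_1^T M A_1) / 2]. *)
Fixpoint avg (V : lmodType R) (n : nat) (phi : seq bool -> V) : V :=
  if n is k.+1 then
    2^-1 *: (avg k (fun w => phi (rcons w false)) + avg k (fun w => phi (rcons w true)))
  else phi [::].

Lemma eq_avg (V : lmodType R) n (phi psi : seq bool -> V) :
  phi =1 psi -> avg n phi = avg n psi.
Proof.
elim: n phi psi => [|n IH] phi psi pp /=; first exact: pp.
by congr (_ *: (_ + _)); apply: IH => w.
Qed.

Lemma avg_morph (V W : lmodType R) (f : V -> W) n phi :
  (forall x y, f (x + y) = f x + f y) -> (forall a x, f (a *: x) = a *: f x) ->
  f (avg n phi) = avg n (fun w => f (phi w)).
Proof. by move=> fD fZ; elim: n phi => //= n IH phi; rewrite fZ fD !IH. Qed.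

Lemma avg_sum (V : lmodType R) (I : finType) n (phi : I -> seq bool -> V) :
  avg n (fun w => \sum_i phi i w) = \sum_i avg n (phi i).
Proof.
by elim: n phi => //= n IH phi; rewrite !IH -big_split -scaler_sumr.
Qed.

Lemma ler_avg n (phi psi : seq bool -> R^o) :
  (forall w, phi w <= psi w) -> avg n phi <= avg n psi.
Proof.
elim: n phi psi => [|n IH] phi psi pp /=; first exact: pp.
by rewrite ler_pM2l// lerD// IH.
Qed.

Lemma avg_const (V : lmodType R) n (c : V) : avg n (fun=> c) = c.
Proof.
by elim: n => //= n ->; rewrite -[c + c]mulr2n -[c *+ 2]scaler_nat scalerA mulVf// scale1r.
Qed.

Lemma avg_norm (V : normedModType R) n (phi : seq bool -> V) :
  `|avg n phi| <= avg n (fun w => `|phi w| : R^o).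
Proof.
elim: n phi => //= n IH phi; rewrite normrZ ger0_norm// ler_pM2l//.
by apply: le_trans (ler_normD _ _) _; rewrite lerD.
Qed.

Lemma avg_cat (V : lmodType R) n k (phi : seq bool -> V) :
  avg (n + k) phi = avg n (fun w => avg k (fun u => phi (u ++ w))).
Proof.
elim: n phi => [|n IH] phi /=; first by apply: eq_avg => w; rewrite cats0.
rewrite !IH; congr (_ *: (_ + _)); apply: eq_avg => w; apply: eq_avg => u;
by rewrite -rcons_cat.
Qed.

Lemma avg_exists n (phi : seq bool -> R^o) :
  exists2 w, size w = n & phi w <= avg n phi.
Proof.
elim: n phi => [|n IH] phi /=; first by exists [::].
set a := avg n _; set b := avg n _.
have [ab|ab] := leP a b.
- have [w wn wa] := IH (fun w => phi (rcons w false)).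
  exists (rcons w false); rewrite ?size_rcons ?wn//; apply: le_trans wa _.
  by rewrite -/a /GRing.scale/=; lra.
- have [w wn wa] := IH (fun w => phi (rcons w true)).
  exists (rcons w true); rewrite ?size_rcons ?wn//; apply: le_trans wa _.
  by rewrite -/b /GRing.scale/=; lra.
Qed.

End WordAverage.

(** * Frobenius norm and quadratic forms *)

Section Frobenius.
Variable R : realType.

(** The Frobenius norm is kept squared, so that its identities are polynomial. *)
Definition fro m n (A : 'M[R]_(m, n)) : R := \sum_i \sum_j A i j ^+ 2.

Lemma fro_ge0 m n (A : 'M[R]_(m, n)) : 0 <= fro A.
Proof. by apply: sumr_ge0 => i _; apply: sumr_ge0 => j _; exact: sqr_ge0. Qed.

Lemma fro_entry m n (A : 'M[R]_(m, n)) i j : A i j ^+ 2 <= fro A.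
Proof.
rewrite /fro (bigD1 i)//= (bigD1 j)//= -addrA lerDl addr_ge0//.
  by apply: sumr_ge0 => k _; exact: sqr_ge0.
by apply: sumr_ge0 => l _; apply: sumr_ge0 => k _; exact: sqr_ge0.
Qed.

Lemma norm_sqr_fro m n (A : 'M[R]_(m, n)) : `|A| ^+ 2 <= fro A.
Proof.
rewrite -[leRHS]sqr_sqrtr ?fro_ge0// lerXn2r ?nnegrE ?sqrtr_ge0//.
apply: mx_norm_leP => [|i j]; first exact: sqrtr_ge0.
rewrite -(ler_pXn2r (_ : 0 < 2)%N) ?nnegrE ?sqrtr_ge0// sqr_sqrtr ?fro_ge0//.
by rewrite real_normK ?num_real// fro_entry.
Qed.

Lemma fro_le m n (A : 'M[R]_(m, n)) : fro A <= (m * n)%:R * `|A| ^+ 2.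
Proof.
apply: (@le_trans _ _ (\sum_(i < m) \sum_(j < n) `|A| ^+ 2)).
  apply: ler_sum => i _; apply: ler_sum => j _.
  by rewrite -real_normK ?num_real// lerXn2r ?nnegrE// mx_norm_entry.
by rewrite !sumr_const !card_ord -mulrnA mulr_natl mulnC.
Qed.

Lemma fro_tr m n (A : 'M[R]_(m, n)) : fro A = \tr (A^T *m A).
Proof.
rewrite /fro exchange_big; apply: eq_bigr => j _; rewrite mxE.
by apply: eq_bigr => i _; rewrite mxE expr2.
Qed.

(** The parallelogram law, a quantitative strict convexity: the subtracted term later forces two
    Gram matrices to coincide. *)
Lemma fro_half m n (A B : 'M[R]_(m, n)) :
  fro (2^-1 *: (A + B)) = 2^-1 * (fro A + fro B) - 4^-1 * fro (A - B).
Proof.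
rewrite /fro -big_split !mulr_sumr -sumrB; apply: eq_bigr => i _ /=.
rewrite -big_split !mulr_sumr -sumrB; apply: eq_bigr => j _ /=.
by rewrite !mxE; field.
Qed.

Definition qform m (Q : 'M[R]_m) (x : 'cV[R]_m) : R := (x^T *m Q *m x) 0 0.

Lemma qform_fro m n (A : 'M[R]_(m, n)) x : qform (A^T *m A) x = fro (A *m x).
Proof. by rewrite fro_tr trace_mx11 /qform trmx_mul !mulmxA. Qed.

Lemma qform1 m (x : 'cV[R]_m) : qform 1%:M x = fro x.
Proof. by rewrite fro_tr trace_mx11 /qform mulmx1. Qed.

Lemma qformD m (P Q : 'M[R]_m) x : qform (P + Q) x = qform P x + qform Q x.
Proof. by rewrite /qform mulmxDr mulmxDl mxE. Qed.

Lemma qformB m (P Q : 'M[R]_m) x : qform (P - Q) x = qform P x - qform Q x.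
Proof. by rewrite /qform mulmxBr mulmxBl !mxE. Qed.

Lemma qformZ m a (Q : 'M[R]_m) x : qform (a *: Q) x = a * qform Q x.
Proof. by rewrite /qform -scalemxAr -scalemxAl mxE. Qed.

Lemma qform_mul m n (Q : 'M[R]_m) (A : 'M[R]_(m, n)) x :
  qform (A^T *m Q *m A) x = qform Q (A *m x).
Proof. by rewrite /qform trmx_mul !mulmxA. Qed.

Lemma qform_parallelogram m (Q : 'M[R]_m) x y :
  qform Q (x + y) + qform Q (x - y) = 2 * (qform Q x + qform Q y).
Proof.
have trD : (x + y)^T = x^T + y^T by rewrite raddfD.
have trB : (x - y)^T = x^T - y^T by rewrite raddfB.
rewrite /qform trD trB !mulmxDl !mulmxDr !mulNmx !mulmxN.
by rewrite !mxE; ring.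
Qed.

Lemma qform_scale m (Q : 'M[R]_m) a x : qform Q (a *: x) = a ^+ 2 * qform Q x.
Proof.
have trZ : (a *: x)^T = a *: x^T by rewrite linearZ.
by rewrite /qform trZ -!scalemxAl -scalemxAr [LHS]mxE [X in _ * X]mxE mulrA expr2.
Qed.

Lemma qform_le m (Q : 'M[R]_m) x : `|qform Q x| <= m%:R * (m%:R * `|x| * `|x|) * `|Q|.
Proof.
apply: le_trans (mx_norm_entry _ _ _) _.
have xx : `|x^T| <= `|x| by apply: mx_norm_leP => // i j; rewrite mxE mx_norm_entry.
apply: le_trans (mx_normM _ _) _.
apply: (@le_trans _ _ (m%:R * (m%:R * `|x^T| * `|Q|) * `|x|)).
  by rewrite ler_wpM2r// ler_wpM2l// mx_normM.
rewrite [leLHS](_ : _ = `|x^T| * (m%:R * m%:R * `|Q| * `|x|)); last by ring.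
rewrite [leRHS](_ : _ = `|x| * (m%:R * m%:R * `|Q| * `|x|)); last by ring.
by rewrite ler_wpM2r// !mulr_ge0.
Qed.

End Frobenius.

(** * Irreducible pairs of matrices *)

(** Induction by eliminating the first variable: the congruence by [T] splits off the pivot [a] and
    leaves the Schur complement [D']. *)
Lemma positive_form_cholesky (R : realType) n (Q : 'M[R]_n) :
  Q^T = Q -> (forall x, x != 0 -> 0 < qform Q x) ->
  exists2 S, S \in unitmx & S^T *m Q *m S = 1%:M.
Proof.
elim: n Q => [|n IH] Q QT Qpos.
  by exists 1%:M; rewrite ?unitmx1//; apply/matrixP => -[].
pose Q1 : 'M[R]_(1 + n) := Q.
pose a := ulsubmx Q1 0 0; pose b := ursubmx Q1; pose D := drsubmx Q1.
have aE : ulsubmx Q1 = a%:M by rewrite [LHS]mx11_scalar.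
have bE : dlsubmx Q1 = b^T by rewrite /b trmx_ursub /Q1 QT.
have DT : D^T = D by rewrite /D trmx_drsub /Q1 QT.
have QE : Q1 = block_mx a%:M b b^T D by rewrite -aE -bE submxK.
have a0 : 0 < a.
  have := Qpos (delta_mx 0 0); rewrite /qform trmx_delta -rowE -colE !mxE.
  suff -> : a = Q 0 0 by apply; apply/eqP => /matrixP/(_ 0 0)/eqP; rewrite !mxE !eqxx oner_eq0.
  by rewrite /a !mxE; congr (Q _ _); apply/val_inj.
pose T : 'M[R]_(1 + n) := block_mx 1%:M (- (a^-1 *: b)) 0 1%:M.
pose D' := D - a^-1 *: (b^T *m b).
have TQT : T^T *m Q1 *m T = block_mx a%:M 0 0 D'.
  rewrite QE /T tr_block_mx !mulmx_block !trmx1 !trmx0 !(mul1mx, mul0mx, mulmx1, mulmx0, addr0, add0r).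
  have -> : (- (a^-1 *: b))^T = - (a^-1 *: b^T) by rewrite raddfN /= linearZ.
  rewrite !mulmxN !mulNmx -!scalemxAl -!scalemxAr.
  rewrite mul_mx_scalar mul_scalar_mx !scalerA mulVf ?mulfV ?gt_eqF// !scale1r.
  rewrite !addNr mul0mx scaler0 oppr0 add0r.
  by rewrite /D' [- _ + D]addrC.
have [||S' _ S'1] := IH D'.
- rewrite /D' raddfB /= linearZ /= trmx_mul trmxK DT//.
(* The Schur complement at [y] is the value of [Q] at [T (0, y)], hence positive. *)
- move=> y y0; have := Qpos (T *m col_mx 0 y).
  rewrite -qform_mul TQT /qform tr_col_mx trmx0 mul_row_block mul_row_col.
  rewrite !(mul0mx, mulmx0, add0r); apply.
  apply: contra y0 => /eqP; rewrite /T mul_block_col !(mul1mx, mul0mx, add0r).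
  by move=> /(congr1 (dsubmx : 'M[R]_(1 + n, 1) -> 'M[R]_(n, 1))); rewrite col_mxKd linear0 => ->.
pose E : 'M[R]_(1 + n) := block_mx (Num.sqrt a)^-1%:M 0 0 S'.
have H : (T *m E)^T *m Q1 *m (T *m E) = 1%:M.
  rewrite trmx_mul -!mulmxA [T^T *m _]mulmxA [_ *m (T *m _)]mulmxA TQT.
  rewrite /E tr_block_mx !mulmx_block !trmx0 !(mul0mx, mulmx0, addr0, add0r).
  rewrite [S'^T *m _]mulmxA S'1 tr_scalar_mx -!scalar_mxM.
  have -> : (Num.sqrt a)^-1 * (a * (Num.sqrt a)^-1) = 1.
    by rewrite mulrCA -invfM -expr2 sqr_sqrtr ?ltW// mulfV// gt_eqF.
  by rewrite -scalar_mx_block.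
exists (T *m E) => //.
by case: (mulmx1_unit H).
Qed.

Section IrreduciblePair.
Variables (R : realType) (m : nat) (A : bool -> 'M[R]_m).
Hypothesis Airr : mx_irreducible_pair A.

Lemma irreducible_subspace (S : 'cV[R]_m -> Prop) :
  S 0 -> (forall a x y, S x -> S y -> S (a *: x + y)) ->
  (forall k x, S x -> S (A k *m x)) ->
  (forall x, S x -> x = 0) \/ (forall x, S x).
Proof.
move=> S0 SD SA; have [U UP] := subspace_vspace S0 SD.
have [|U0|UT] := Airr (U := U); first by move=> k x /UP /SA /UP.
- by left=> x /UP; rewrite U0 memv0 => /eqP.
- by right=> x; apply/UP; rewrite UT memvf.
Qed.

(** The vectors with bounded orbit form an invariant subspace. If it is everything, uniform
    boundedness concludes; the case of the zero subspace has to be excluded. *)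
Lemma irreducible_bounded :
  (forall q, 1 < q -> growth A q) -> exists C, forall w, `|wprod A w| <= C.
Proof.
move=> Ag.
pose L (x : 'cV[R]_m) := exists C, forall w, `|wprod A w *m x| <= C.
have [|a x y [C CP] [C' CP']|k x [C CP]|L0|L1] := @irreducible_subspace L.
- by exists 0 => w; rewrite mulmx0 normr0.
- exists (`|a| * C + C') => w; rewrite mulmxDr -scalemxAr.
  by rewrite (le_trans (ler_normD _ _))// lerD// normrZ ler_wpM2l.
- by exists C => w; rewrite mulmxA -wprod_rcons.
(* If no orbit of a nonzero vector is bounded, then by compactness of the sphere
   every vector is doubled by a word of length at most n, which contradicts
   subexponential growth. *)
- have [n nP] : exists n, forall x : 'cV[R]_m, `|x| = 1 ->
      exists2 w, (size w <= n)%N & 2 <= `|wprod A w *m x|.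
    apply: contrapT => /forallNP Nn.
    have /choice[X XP] : forall n, exists x : 'cV[R]_m, `|x| = 1 /\
        forall w, (size w <= n)%N -> `|wprod A w *m x| <= 2.
      move=> n; have /existsNP[x /not_implyP[x1 xP]] := Nn n.
      exists x; split=> // w wn; rewrite leNgt; apply/negP => /ltW w2.
      by apply: xP; exists w.
    (* Unit vectors that words of length at most [n] do not double accumulate at a unit vector with
       bounded orbit. *)
    have [|Y YP] := @mx_cluster _ _ _ X 1.
      by move=> k; rewrite (XP k).1.
    have /L0 Y0 : L Y.
      exists (2 + m%:R * (m%:R * 0 + 1) + m%:R * 1) => w.
      have [|k wk XY] := YP (`|wprod A w| + 1)^-1 _ (size w).
        by rewrite invr_gt0 ltr_wpDl.
      rewrite -[Y](subKr (X k)) mulmxBr (le_trans (ler_normB _ _))//.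
      rewrite mulr0 add0r -addrA lerD//; first exact: (XP k).2.
      rewrite (le_trans (mx_normM _ _))// -mulrA -mulrDr ler_wpM2l//.
      apply: (@le_trans _ _ 1); last by lra.
      rewrite (@le_trans _ _ (`|wprod A w| * (`|wprod A w| + 1)^-1))// ?ler_wpM2l//.
      by rewrite ler_pdivrMr ?ltr_wpDl// mul1r lerDl.
    have [k _] := YP 2^-1 ltac:(by []) 0%N.
    by rewrite Y0 subr0 (XP k).1; lra.
  have it j : forall x : 'cV[R]_m, `|x| = 1 ->
      exists2 w, (size w <= n * j)%N & 2 ^+ j <= `|wprod A w *m x|.
    elim: j => [|j IH] x x1; first by exists [::]; rewrite //= mul1mx x1.
    have [w wn w2] := nP x x1.
    set y := wprod A w *m x in w2; have y0 : 0 < `|y| by apply: lt_le_trans w2.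
    have [|u un u2] := IH (`|y|^-1 *: y).
      by rewrite normrZ normfV normr_id mulVf// gt_eqF.
    exists (u ++ w); first by rewrite size_cat mulnS addnC leq_add.
    rewrite wprod_cat -mulmxA -/y exprS.
    move: u2; rewrite -scalemxAr normrZ normfV normr_id ler_pdivlMl// => u2.
    by apply: le_trans u2; rewrite ler_wpM2r ?exprn_ge0.
  (* The bound 0 is a placeholder: an entry index [i] yields a unit vector, and from it a
     contradiction. *)
  exists 0 => w; apply: mx_norm_leP => // i j; exfalso.
  have [x x1] : exists x : 'cV[R]_m, `|x| = 1.
    exists (delta_mx i 0); apply/eqP; rewrite eq_le; apply/andP; split.
      by apply: mx_norm_leP => // k l; rewrite mxE; case: (_ && _); rewrite ?normr1 ?normr0.
    by have := mx_norm_entry (delta_mx i (0 : 'I_1) : 'cV[R]_m) i 0; rewrite mxE !eqxx normr1.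
  (* Each doubling costs at most [n] letters, so growth at this rate gives [2^k <= m C (3/2)^k],
     which fails for large [k]. *)
  pose q : R := (3 / 2) `^ (n.+1%:R^-1).
  have qn : q ^+ n.+1 = 3 / 2.
    by rewrite /q -powR_mulrn ?powR_ge0// -powRrM mulVf// powRr1// divr_ge0.
  have q1 : 1 < q.
    rewrite ltNge; apply/negP => q1; have := exprn_ile1 n.+1 (powR_ge0 _ _ : 0 <= q) q1.
    by rewrite qn; lra.
  have [C CP] := Ag _ q1.
  have C0 : 0 <= C by have := CP [::]; rewrite expr0 mulr1; apply: le_trans.
  have bnd k : 2 ^+ k <= m%:R * C * (3 / 2) ^+ k.
    have [u un u2] := it k x x1; apply: (le_trans u2).
    rewrite (le_trans (mx_normM _ _))// x1 mulr1 -mulrA ler_wpM2l//.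
    rewrite (le_trans (CP u))// ler_wpM2l// -qn -exprM.
    by rewrite ler_weXn2l ?ltW// (leq_trans un)// leq_mul2r leqnSn orbT.
  have [||N NP] := @expr_small R (3 / 4) (m%:R * C + 1)^-1.
  - by apply/andP; split; lra.
  - by rewrite invr_gt0 ltr_wpDl// mulr_ge0.
  have := bnd N; apply/negP; rewrite -ltNge.
  have K0 : 0 < m%:R * C + 1 by rewrite ltr_wpDl// mulr_ge0.
  have -> : (3 / 2 : R) = 2 * (3 / 4) by field.
  rewrite exprMn mulrCA gtr_pMr ?exprn_gt0//.
  apply: (@le_lt_trans _ _ (m%:R * C * (m%:R * C + 1)^-1)).
    by rewrite ler_wpM2l ?mulr_ge0// NP.
  by rewrite ltr_pdivrMr// mul1r ltrDl.
- have [C _ CP] := mx_norm_bounded_pointwise L1.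
  by exists C.
Qed.

End IrreduciblePair.

(** Asymptotic lower bounds pass to cluster points. The Lipschitz estimate is asked only between the
    sequence and [Y], so that quadratic [f] qualify. *)
Lemma cluster_ge (R : realType) m n (X : nat -> 'M[R]_(m, n)) (Y : 'M[R]_(m, n))
    (f : 'M[R]_(m, n) -> R) (K c : R) :
  (forall e : R, 0 < e -> forall N, exists2 k, (N <= k)%N & `|X k - Y| <= e) ->
  (forall k, `|f (X k) - f Y| <= K * `|X k - Y|) ->
  (forall e : R, 0 < e -> exists N, forall k, (N <= k)%N -> c - e <= f (X k)) ->
  c <= f Y.
Proof.
move=> XY fL fX; apply/ler_addgt0Pr => e e0.
have [|N NP] := fX (e / 2); first by rewrite divr_gt0.
have K0 : 0 < `|K| + 1 by rewrite ltr_wpDl.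
have [|k Nk kP] := XY (e / 2 / (`|K| + 1)) _ N; first by rewrite !divr_gt0.
have h1 := NP k Nk.
have h2 : f (X k) - f Y <= e / 2.
  apply: le_trans (ler_norm _) _; apply: le_trans (fL k) _.
  apply: (@le_trans _ _ ((`|K| + 1) * `|X k - Y|)).
    by rewrite ler_wpM2r// (le_trans (ler_norm K))// lerDl.
  by rewrite mulrC -ler_pdivlMr.
by lra.
Qed.

Lemma fro_diff (R : realType) m n (P Q : 'M[R]_(m, n)) :
  `|fro P - fro Q| <= (m * n)%:R * (`|P - Q| * (`|P| + `|Q|)).
Proof.
rewrite /fro -sumrB (le_trans (ler_norm_sum _ _ _))//.
apply: (@le_trans _ _ (\sum_(i < m) \sum_(j < n) `|P - Q| * (`|P| + `|Q|))).
  apply: ler_sum => i _; rewrite -sumrB (le_trans (ler_norm_sum _ _ _))//.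
  apply: ler_sum => j _; rewrite subr_sqr normrM ler_pM//.
    by have := mx_norm_entry (P - Q) i j; rewrite !mxE.
  by rewrite (le_trans (ler_normD _ _))// lerD// mx_norm_entry.
by rewrite !sumr_const !card_ord -mulrnA [leRHS]mulr_natl mulnC.
Qed.

(** * Bounded products preserving the Euclidean norm in the mean *)

Section BoundedPair.
Variables (R : realType) (m : nat) (A : bool -> 'M[R]_m) (C : R).
Hypotheses (m0 : (0 < m)%N) (Airr : mx_irreducible_pair A).
Hypothesis Aunit : forall k, A k \in unitmx.
Hypothesis Abnd : forall w, `|wprod A w| <= C.

Let C0 : 0 <= C. Proof. exact: le_trans (normr_ge0 _) (Abnd [::]). Qed.

Lemma wprod_unit w : wprod A w \in unitmx.
Proof. by elim: w => [|b w IH] /=; rewrite ?unitmx1// unitmx_mul Aunit. Qed.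

Section Unital.
Hypothesis Aunital : (A false)^T *m A false + (A true)^T *m A true = 2 *: 1%:M.

Let fro_step (x : 'cV[R]_m) : fro (A false *m x) + fro (A true *m x) = 2 * fro x.
Proof. by rewrite -!qform_fro -qformD Aunital qformZ qform1. Qed.

(* Maximize the norm over the closure of an orbit: by the mean-value identity
   fro_step the maximum propagates along all words. *)
Lemma level_set_nonempty : exists (s : R) (z : 'cV[R]_m),
  0 < s /\ forall u, fro (wprod A u *m z) = s.
Proof.
pose x0 : 'cV[R]_m := delta_mx (Ordinal m0) 0.
pose E := [set fro (wprod A w *m x0) | w in [set: seq bool]].
have nC w : `|wprod A w *m x0| <= m%:R * C * `|x0|.
  by rewrite (le_trans (mx_normM _ _))// ler_wpM2r// ler_wpM2l.
have Esup : has_sup E.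
  split; first by exists (fro (wprod A [::] *m x0)); exists [::].
  exists ((m * 1)%:R * (m%:R * C * `|x0|) ^+ 2) => _ [w _ <-].
  rewrite (le_trans (fro_le _))// ler_wpM2l// lerXn2r// ?nnegrE ?mulr_ge0//.
have sub w : fro (wprod A w *m x0) <= sup E.
  by apply: ub_le_sup; [case: Esup|exists w].
have s0 : 0 < sup E.
  apply: lt_le_trans (sub [::]); rewrite /= mul1mx.
  by apply: lt_le_trans (fro_entry _ (Ordinal m0) 0); rewrite mxE !eqxx expr1n.
have /choice[W WP] : forall n : nat, exists w,
    sup E - n.+1%:R^-1 < fro (wprod A w *m x0).
  move=> n; have [|_ [w _ <-] wP] := sup_adherent (_ : 0 < n.+1%:R^-1) Esup.
    by rewrite invr_gt0.
  by exists w.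
have [y yP] := mx_cluster (fun n => nC (W n)).
have diffK u k : `|fro (wprod A u *m (wprod A (W k) *m x0)) - fro (wprod A u *m y)|
    <= ((m * 1)%:R * (m%:R * C * (m%:R * C * (m%:R * C * `|x0|) + m%:R * C * `|y|)))
       * `|wprod A (W k) *m x0 - y|.
  have AC (z : 'cV[R]_m) : `|wprod A u *m z| <= m%:R * C * `|z|.
    by rewrite (le_trans (mx_normM _ _))// ler_wpM2r// ler_wpM2l.
  rewrite (le_trans (fro_diff _ _))// -mulmxBr -mulrA ler_wpM2l//.
  rewrite [leRHS]mulrAC ler_pM ?addr_ge0//.
  apply: lerD; last exact: AC.
  by apply: le_trans (AC _) _; rewrite ler_wpM2l// ?mulr_ge0.
have yle u : fro (wprod A u *m y) <= sup E.
  rewrite -lerN2; apply: (cluster_ge (f := fun z => - fro (wprod A u *m z)) yP).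
    by move=> k; rewrite -opprD normrN; exact: diffK.
  move=> e e0; exists 0%N => k _; rewrite mulmxA -wprod_cat.
  by have := sub (u ++ W k); lra.
have yge : sup E <= fro y.
  apply: (cluster_ge yP).
    by move=> k; have := diffK [::] k; rewrite /= !mul1mx; exact.
  move=> e e0; have [N _ NP] := near_infty_natSinv_lt (PosNum e0).
  exists N => k Nk; have := WP k; have := NP k Nk => /= h1 h2; apply: ltW; apply: le_lt_trans h2; rewrite lerB// ltW//.
exists (sup E); exists y; split=> // u.
elim/last_ind: u {yP diffK} y yle yge => [|u b IH] y yle yge.
  by rewrite mul1mx; apply/eqP; rewrite eq_le yge andbT; have := yle [::]; rewrite mul1mx.
rewrite wprod_rcons -mulmxA; apply: IH => [u'|].
  by rewrite mulmxA -wprod_rcons.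
have := fro_step y; have := yle [:: false]; have := yle [:: true].
by rewrite /= !mulmx1; case: b; lra.
Qed.

Lemma level_set_inverse (s : R) (z : 'cV[R]_m) :
  (forall u, fro (wprod A u *m z) = s) ->
  forall w u, fro (wprod A u *m (invmx (wprod A w) *m z)) = s.
Proof.
move=> zs.
pose Z (z : 'cV[R]_m) := forall u, fro (wprod A u *m z) = s.
have ZA b x : Z x -> Z (A b *m x).
  by move=> Zx u; rewrite mulmxA -wprod_rcons.
suff ZV b x : Z x -> Z (invmx (A b) *m x).
  move=> w; elim: w z zs => [|b w IH] x Zx.
    by rewrite /= invmx1 mul1mx.
  have -> : invmx (wprod A (b :: w)) *m x = invmx (wprod A w) *m (invmx (A b) *m x).
    rewrite -{1}[x](mulKVmx (Aunit b)) -{1}[invmx (A b) *m x](mulKVmx (wprod_unit w)).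
    by rewrite mulmxA -/(wprod A (b :: w)) mulKmx// wprod_unit.
  by apply: IH; exact: ZV.
move=> Zx.
(* Z is cut out by the forms in W, and M |-> A_b^T M A_b is injective on the
   finite-dimensional space W, hence onto. *)
pose W (M : 'M[R]_m) := forall z, Z z -> qform M z = 0.
have [|a M N WM WN y Zy|U UP] := @subspace_vspace R _ W.
- by move=> y _; rewrite /qform mulmx0 mul0mx mxE.
- by rewrite qformD qformZ WM// WN// mulr0 addr0.
pose f M : 'M[R]_m := (A b)^T *m M *m A b.
pose F := linfun (mulmxr (A b) \o mulmx (A b)^T : 'M[R]_m -> 'M[R]_m).
have FE M : F M = f M by rewrite lfunE.
have FI : injective F.
  move=> M N; rewrite !FE /f => MN; apply: (row_full_inj (A := (A b)^T)).
    by rewrite row_full_unit unitmx_tr.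
  by apply: (row_free_inj (A := A b)); rewrite ?row_free_unit.
have WV M : W M -> W ((invmx (A b))^T *m M *m invmx (A b)).
  move=> WM; apply/UP; apply: (stable_vspace_inj FI) => [N /UP WN|].
    by apply/UP => y Zy; rewrite FE qform_mul; apply: WN; exact: ZA.
  rewrite FE /f; apply/UP; rewrite !mulmxA -trmx_mul mulVmx// trmx1 mul1mx.
  by rewrite -mulmxA mulVmx// mulmx1.
(* Equality of the norms along [u] and [v] is the vanishing of a form in [W]. These equations carry
   over to [A_b^(-1) x], where the word [[:: b]] identifies the common value as [s]. *)
have W0 u v : W ((wprod A u)^T *m wprod A u - (wprod A v)^T *m wprod A v).
  by move=> y Zy; rewrite qformB !qform_fro !Zy subrr.
have V0 u v : fro (wprod A u *m (invmx (A b) *m x)) = fro (wprod A v *m (invmx (A b) *m x)).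
  have := WV _ (W0 u v) _ Zx; rewrite qform_mul qformB !qform_fro => /eqP.
  by rewrite subr_eq0 => /eqP.
move=> u; rewrite (V0 u [:: b]) /= mulmx1 mulmxA mulmxV// mul1mx.
by have := Zx [::]; rewrite /= mul1mx.
Qed.

(** Inverse products keep the norm of points of [Z], so the vectors with bounded inverse orbit
    contain the span of [Z]. This span is invariant and nonzero, hence everything. *)
Lemma invmx_wprod_bounded : exists2 C', 0 <= C' & forall w, `|invmx (wprod A w)| <= C'.
Proof.
have [s [z0 [s0 Zz0]]] := level_set_nonempty.
pose Z (z : 'cV[R]_m) := forall u, fro (wprod A u *m z) = s.
apply: mx_norm_bounded_pointwise.
pose L (x : 'cV[R]_m) := exists C, forall w, `|invmx (wprod A w) *m x| <= C.
have [|a x y [D DP] [D' DP']|U UP] := @subspace_vspace R _ L.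
- by exists 0 => w; rewrite mulmx0 normr0.
- exists (`|a| * D + D') => w; rewrite mulmxDr -scalemxAr.
  by rewrite (le_trans (ler_normD _ _))// lerD// normrZ ler_wpM2l.
(* The span of [Z] as the intersection of the subspaces containing it; invariance follows by pulling
   [V] back through [A k]. *)
pose S x := forall V : {vspace 'cV[R]_m}, (forall z, Z z -> z \in V) -> x \in V.
have [|||S0|S1] := irreducible_subspace Airr (S := S).
- by move=> V _; exact: mem0v.
- by move=> a x y Sx Sy V ZV; rewrite memvD// ?memvZ// ?Sx ?Sy.
- move=> k x Sx V ZV.
  pose F := linfun (mulmx (A k) : 'cV[R]_m -> 'cV[R]_m).
  have := Sx (F @^-1: V)%VS; rewrite -memv_preim lfunE; apply => y Zy.
  rewrite -memv_preim lfunE; apply: ZV => u.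
  by rewrite /= mulmxA -wprod_rcons.
- have := Zz0 [::]; rewrite mul1mx.
  have -> : z0 = 0 by apply: S0 => V; apply.
  rewrite /fro big1 => [/esym/eqP|i _]; first by rewrite gt_eqF.
  by rewrite big1// => j _; rewrite mxE expr0n.
- move=> x; apply/UP/S1 => z Zz; apply/UP; exists (s + 1) => w.
  have := level_set_inverse Zz w [::]; rewrite mul1mx => zs.
  have := norm_sqr_fro (invmx (wprod A w) *m z); rewrite zs.
  by set t := `|_|; nra.
Qed.

(* G_w(1) is the mean of G_(0w)(1) and G_(1w)(1), so by the parallelogram law a
   nonzero difference D would push sup_w |G_w(1)| strictly below itself. *)
Lemma unital_orthogonal k : orthogonal_mx (A k).
Proof.
have [C' C'0 VC] := invmx_wprod_bounded.
pose G w (M : 'M[R]_m) := (wprod A w)^T *m M *m wprod A w.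
have Gcons b w : G (b :: w) 1%:M = (wprod A w)^T *m ((A b)^T *m A b) *m wprod A w.
  by rewrite /G /= trmx_mul mulmx1 !mulmxA.
pose D := (A false)^T *m A false - (A true)^T *m A true.
have trle p q (M : 'M[R]_(p, q)) : `|M^T| <= `|M|.
  by apply: mx_norm_leP => // i j; rewrite mxE mx_norm_entry.
have GC w : `|G w 1%:M| <= m%:R * C * C.
  rewrite /G mulmx1 (le_trans (mx_normM _ _))// ler_pM ?mulr_ge0//.
  by rewrite ler_wpM2l// (le_trans (trle _ _ _)).
pose E := [set fro (G w 1%:M) | w in [set: seq bool]].
have Esup : has_sup E.
  split; first by exists (fro (G [::] 1%:M)); exists [::].
  exists ((m * m)%:R * (m%:R * C * C) ^+ 2) => _ [w _ <-].
  by rewrite (le_trans (fro_le _))// ler_wpM2l// lerXn2r// ?nnegrE ?mulr_ge0.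
have sub w : fro (G w 1%:M) <= sup E.
  by apply: ub_le_sup; [case: Esup|exists w].
(* Bounded inverses make [G w] bounded below uniformly in [w], so a nonzero [D] gives the same
   strict loss for every word. *)
pose K := m%:R * m%:R * C' * C' + 1.
have K0 : 0 < K by rewrite ltr_wpDl// !mulr_ge0.
have DK w : `|D| <= K * `|G w D|.
  have {1}-> : D = (invmx (wprod A w))^T *m G w D *m invmx (wprod A w).
    rewrite /G !mulmxA -trmx_mul mulmxV ?wprod_unit// trmx1 mul1mx -mulmxA.
    by rewrite mulmxV ?wprod_unit// mulmx1.
  rewrite (le_trans (mx_normM _ _))//.
  apply: (@le_trans _ _ (m%:R * (m%:R * C' * `|G w D|) * C')); last first.
    rewrite (_ : _ * C' = m%:R * m%:R * C' * C' * `|G w D|); last by ring.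
    by rewrite ler_wpM2r// lerDl.
  rewrite ler_pM ?mulr_ge0// ler_wpM2l// (le_trans (mx_normM _ _))//.
  by rewrite ler_wpM2r// ler_wpM2l// (le_trans (trle _ _ _)).
have step w : fro (G w 1%:M) <= sup E - 4^-1 * (`|D| / K) ^+ 2.
  have -> : G w 1%:M = 2^-1 *: (G (false :: w) 1%:M + G (true :: w) 1%:M).
    rewrite !Gcons -mulmxDl -mulmxDr Aunital -scalemxAr -scalemxAl.
    by rewrite scalerA mulVf// scale1r.
  rewrite fro_half.
  have -> : G (false :: w) 1%:M - G (true :: w) 1%:M = G w D.
    by rewrite !Gcons -mulmxBl -mulmxBr.
  have := sub (false :: w); have := sub (true :: w).
  suff : (`|D| / K) ^+ 2 <= fro (G w D) by lra.
  apply: le_trans (norm_sqr_fro _).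
  by rewrite lerXn2r ?nnegrE ?divr_ge0 ?(ltW K0)// ler_pdivrMr// mulrC.
have D0 : D = 0.
  have : sup E <= sup E - 4^-1 * (`|D| / K) ^+ 2.
    by apply: ge_sup => [|_ [w _ <-]]; [case: Esup|exact: step].
  move=> h; have : (`|D| / K) ^+ 2 <= 0 by lra.
  rewrite le_eqVlt ltNge sqr_ge0 orbF sqrf_eq0 mulf_eq0 invr_eq0 (gt_eqF K0) orbF.
  by rewrite normr_eq0 => /eqP.
have eqA : (A false)^T *m A false = (A true)^T *m A true by apply/eqP; rewrite -subr_eq0 -/D D0.
have := Aunital; rewrite /orthogonal_mx.
case: k; rewrite ?eqA -?eqA -mulr2n -scaler_nat => /(scalerI (_ : 2 != 0 :> R)) ->//.
Qed.

End Unital.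
End BoundedPair.

Section Conjugation.
Variables (R : realType) (m : nat) (A : bool -> 'M[R]_m) (S : 'M[R]_m).
Hypothesis Sunit : S \in unitmx.

Definition mx_conj k := invmx S *m A k *m S.

Lemma wprod_conj w : wprod mx_conj w = invmx S *m wprod A w *m S.
Proof.
elim: w => [|b w IH] /=; first by rewrite mulmx1 mulVmx.
by rewrite IH /mx_conj !mulmxA mulmxK.
Qed.

Lemma irreducible_conj : mx_irreducible_pair A -> mx_irreducible_pair mx_conj.
Proof.
move=> Airr U UA.
pose f := linfun (mulmx S : 'cV[R]_m -> 'cV[R]_m).
have [|V0|V1] := Airr (f @: U)%VS.
- move=> k _ /memv_imgP[u uU ->]; have := memv_img f (UA k u uU).
  by rewrite !lfunE /= /mx_conj !mulmxA mulmxV// mul1mx.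
- left; apply/eqP; rewrite -subv0; apply/subvP => u /(memv_img f).
  rewrite V0 !memv0 lfunE /= => /eqP Su.
  by rewrite -[u](mulKmx Sunit) Su mulmx0.
- right; apply/vspaceP => x; rewrite memvf; have : f x \in (f @: U)%VS by rewrite V1 memvf.
  move=> /memv_imgP[u uU]; rewrite !lfunE /= => /(congr1 (mulmx (invmx S))).
  by rewrite !mulKmx// => ->.
Qed.

End Conjugation.

(** * Decay in the mean, or a common Euclidean structure *)

Section Dichotomy.
Variables (R : realType) (m : nat) (A : bool -> 'M[R]_m) (C : R).
Hypotheses (m0 : (0 < m)%N) (Airr : mx_irreducible_pair A).
Hypothesis Aunit : forall k, A k \in unitmx.
Hypothesis Abnd : forall w, `|wprod A w| <= C.

Let C0 : 0 <= C. Proof. exact: le_trans (normr_ge0 _) (Abnd [::]). Qed.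

Let a n : R := avg n (fun w => `|wprod A w| ^+ 2 : R^o).

Let a_ge0 n : 0 <= a n.
Proof.
by rewrite -(avg_const n (0 : R^o)); apply: ler_avg => w; rewrite exprn_ge0.
Qed.

Let a_le n : a n <= C ^+ 2.
Proof.
rewrite -[leRHS](avg_const n (C ^+ 2 : R^o)); apply: ler_avg => w.
by rewrite lerXn2r ?nnegrE.
Qed.

Let a_submul n k : a (n + k) <= m%:R ^+ 2 * a n * a k.
Proof.
have avgZ j c (phi : seq bool -> R^o) :
    c * avg j phi = avg j (fun w => c * phi w : R^o).
  by apply: (avg_morph (f := fun x : R^o => c * x : R^o)) => *;
    rewrite /GRing.scale /= ?mulrDr// mulrCA.
rewrite /a avg_cat -mulrA [a n * _]mulrC mulrA avgZ; apply: ler_avg => w.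
rewrite -mulrA [_ * _ ^+ 2]mulrC mulrA avgZ; apply: ler_avg => u.
rewrite wprod_cat -!exprMn lerXn2r ?nnegrE ?mulr_ge0//.
by rewrite (le_trans (mx_normM _ _))// mulrAC.
Qed.

(** By submultiplicativity up to the factor [m^2], a single length with [m^2 a n < 1] forces
    geometric decay along its multiples; boundedness of [a] covers the remainders. *)
Lemma avg_decay n : m%:R ^+ 2 * a n < 1 ->
  forall e : R, 0 < e -> exists N, forall k, (N <= k)%N -> a k <= e.
Proof.
move=> an1 e e0.
have iter j k : a (j * n + k) <= (m%:R ^+ 2 * a n) ^+ j * a k.
  elim: j => [|j IH]; first by rewrite mul0n expr0 mul1r.
  rewrite mulSn -addnA (le_trans (a_submul _ _))// [X in _ <= X * _]exprS -[leRHS]mulrA.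
  by rewrite ler_wpM2l// mulr_ge0// exprn_ge0.
have D0 : 0 < C ^+ 2 + 1 by rewrite ltr_wpDl// sqr_ge0.
have [||N NP] := @expr_small R (m%:R ^+ 2 * a n) (e / (C ^+ 2 + 1)).
- by rewrite an1 mulr_ge0// exprn_ge0.
- by rewrite divr_gt0.
exists (N * n)%N => k Nk; rewrite -(subnKC Nk) (le_trans (iter _ _))//.
apply: (@le_trans _ _ (e / (C ^+ 2 + 1) * (C ^+ 2 + 1))).
  rewrite ler_pM ?exprn_ge0 ?mulr_ge0 ?exprn_ge0//; first exact: NP.
  by rewrite (le_trans (a_le _))// lerDl.
by rewrite divfK// gt_eqF.
Qed.

Section Cesaro.
Hypothesis age : forall n, 1 <= m%:R ^+ 2 * a n.

Let trle p q (M : 'M[R]_(p, q)) : `|M^T| <= `|M|.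
Proof. by apply: mx_norm_leP => // i j; rewrite mxE mx_norm_entry. Qed.

Let Q n : 'M[R]_m := avg n (fun w => (wprod A w)^T *m wprod A w).

Let Q_le n : `|Q n| <= m%:R * C * C.
Proof.
apply: le_trans (avg_norm _ _) _.
rewrite -[leRHS](avg_const n (m%:R * C * C : R^o)); apply: ler_avg => w.
rewrite (le_trans (mx_normM _ _))// ler_pM ?mulr_ge0// ler_wpM2l//.
exact: le_trans (trle _) _.
Qed.

Let QT n : (Q n)^T = Q n.
Proof.
rewrite /Q (avg_morph (f := trmx)) => [|x y|c x]; rewrite ?raddfD ?linearZ//.
by apply: eq_avg => w; rewrite trmx_mul trmxK.
Qed.

Let Q_ge0 n x : 0 <= qform (Q n) x.
Proof.
rewrite /Q (avg_morph (W := R^o) (f := fun M => qform M x)) => [|y z|c y].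
- rewrite -(avg_const n (0 : R^o)); apply: ler_avg => w.
  by rewrite qform_fro fro_ge0.
- exact: qformD.
- exact: qformZ.
Qed.

(** This bound on the traces, uniform in [n], keeps the limit form nonzero. *)
Let Q_tr n : m%:R ^- 2 <= \tr (Q n).
Proof.
have mm : 0 < m%:R ^+ 2 :> R by rewrite exprn_gt0// ltr0n.
rewrite /Q (avg_morph (W := R^o) (f := @mxtrace R m)) => [|y z|c y].
- apply: (@le_trans _ _ (a n)); first by rewrite -div1r ler_pdivrMr// mulrC.
  by apply: ler_avg => w; rewrite -fro_tr norm_sqr_fro.
- exact: mxtraceD.
- exact: mxtraceZ.
Qed.

Let T (M : 'M[R]_m) : 'M[R]_m :=
  2^-1 *: ((A false)^T *m M *m A false + (A true)^T *m M *m A true).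

Let TD M N : T (M + N) = T M + T N.
Proof.
rewrite /T !mulmxDr !mulmxDl -scalerDr; congr (_ *: _).
by rewrite !addrA; congr (_ + _); rewrite -!addrA; congr (_ + _); rewrite addrC.
Qed.

Let TZ c M : T (c *: M) = c *: T M.
Proof. by rewrite /T -!scalemxAr -!scalemxAl -scalerDr !scalerA mulrC. Qed.

Let TQ n : T (Q n) = Q n.+1.
Proof.
rewrite /T /Q /=; congr (_ *: (_ + _)).
  rewrite (avg_morph (f := fun M => (A false)^T *m M *m A false)) => [|x y|c x].
  - by apply: eq_avg => w; rewrite wprod_rcons trmx_mul !mulmxA.
  - by rewrite mulmxDr mulmxDl.
  - by rewrite -scalemxAr -scalemxAl.
rewrite (avg_morph (f := fun M => (A true)^T *m M *m A true)) => [|x y|c x].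
- by apply: eq_avg => w; rewrite wprod_rcons trmx_mul !mulmxA.
- by rewrite mulmxDr mulmxDl.
- by rewrite -scalemxAr -scalemxAl.
Qed.

Let T_le M : `|T M| <= (m%:R * (m%:R * C) * C) * `|M|.
Proof.
have AC b : `|A b| <= C by have := Abnd [:: b]; rewrite /= mulmx1.
have one b : `|(A b)^T *m M *m A b| <= (m%:R * (m%:R * C) * C) * `|M|.
  rewrite (le_trans (mx_normM _ _))//.
  rewrite (_ : _ * `|M| = m%:R * (m%:R * C * `|M|) * C); last by ring.
  rewrite ler_pM ?mulr_ge0// ler_wpM2l// (le_trans (mx_normM _ _))//.
  by rewrite ler_wpM2r// ler_wpM2l// (le_trans (trle _)).
rewrite /T normrZ ger0_norm//.
have := ler_normD ((A false)^T *m M *m A false) ((A true)^T *m M *m A true).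
by have := one false; have := one true; lra.
Qed.

(* Any cluster point of the Cesaro means of the T^l(1) = Q l is T-invariant. *)
Let X n : 'M[R]_m := n.+1%:R^-1 *: \sum_(0 <= l < n.+1) Q l.

Let X_le n : `|X n| <= m%:R * C * C.
Proof.
rewrite /X normrZ ger0_norm ?invr_ge0// ler_pdivrMl//.
rewrite (le_trans (ler_norm_sum _ _ _))//.
apply: (@le_trans _ _ (\sum_(0 <= l < n.+1) m%:R * C * C)).
  by apply: ler_sum => l _; exact: Q_le.
by rewrite sumr_const_nat subn0 [leRHS]mulr_natl.
Qed.

Let X_morph (f : 'M[R]_m -> R) n c :
  (forall x y, f (x + y) = f x + f y) -> (forall a x, f (a *: x) = a * f x) ->
  (forall n, c <= f (Q n)) -> c <= f (X n).
Proof.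
move=> fD fZ fQ; have f0 : f 0 = 0 by rewrite -[0](scale0r 0) fZ mul0r.
rewrite /X fZ (big_morph f fD f0) ler_pdivlMl//.
apply: (@le_trans _ _ (\sum_(0 <= l < n.+1) c)).
  by rewrite sumr_const_nat subn0 -[leRHS]mulr_natl.
by apply: ler_sum.
Qed.

(** The sum telescopes because [T (Q l) = Q l.+1], so the defect of invariance is a bounded matrix
    over [n + 1]. *)
Let TX n : T (X n) - X n = n.+1%:R^-1 *: (Q n.+1 - Q 0).
Proof.
have T0 : T 0 = 0 by have := TZ 0 0; rewrite !scale0r.
rewrite /X TZ -scalerBr (big_morph T TD T0) -sumrB; congr (_ *: _).
rewrite -(telescope_sumr Q (leq0n _)); apply: eq_bigr => l _.
by rewrite TQ.
Qed.

(** A cluster point [Y] of the means inherits symmetry, nonnegativity and the trace bound. Its null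
    vectors form an invariant subspace, which is zero because the trace is positive. *)
Lemma invariant_mean_form : exists Y : 'M[R]_m,
  [/\ Y^T = Y, forall x, x != 0 -> 0 < qform Y x & T Y = Y].
Proof.
have [Y YP] := mx_cluster X_le.
have trY : m%:R ^- 2 <= \tr Y.
  apply: (cluster_ge (f := @mxtrace R m) (K := m%:R) YP) => [k|e e0].
    rewrite -raddfB (le_trans (ler_norm_sum _ _ _))//.
    apply: (@le_trans _ _ (\sum_(i < m) `|X k - Y|)).
      by apply: ler_sum => i _; exact: mx_norm_entry.
    by rewrite sumr_const card_ord mulr_natl.
  exists 0%N => k _; apply: (@le_trans _ _ (m%:R ^- 2)); first by lra.
  by apply: X_morph => *; rewrite ?mxtraceD ?mxtraceZ ?Q_tr.
have Y0 x : 0 <= qform Y x.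
  apply: (cluster_ge (f := fun M => qform M x) YP) => [k|e e0].
    by rewrite -qformB; exact: qform_le.
  exists 0%N => k _; rewrite sub0r (@le_trans _ _ 0) ?oppr_le0 ?(ltW e0)//.
  by apply: (X_morph (f := fun M => qform M x)) => *; rewrite ?qformD ?qformZ ?Q_ge0.
have XT n : (X n)^T = X n.
  by rewrite /X linearZ /= raddf_sum /=; congr (_ *: _); apply: eq_bigr => l _; rewrite QT.
have YT : Y^T = Y.
  have h i j : Y i j <= Y j i.
    rewrite -subr_ge0.
    apply: (cluster_ge (f := fun M : 'M[R]_m => M j i - M i j) (K := 2) YP) => [k|e e0].
      rewrite (_ : _ - _ = (X k - Y) j i - (X k - Y) i j); last by rewrite !mxE; ring.
      rewrite (le_trans (ler_normB _ _))//.
      by have := mx_norm_entry (X k - Y) i j; have := mx_norm_entry (X k - Y) j i; lra.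
    exists 0%N => k _; have -> : X k i j = X k j i by rewrite -[X k in LHS](XT k) [LHS]mxE.
    by rewrite subrr; lra.
  by apply/matrixP => i j; rewrite mxE; apply/eqP; rewrite eq_le !h.
have YTY : T Y = Y.
  pose K := m%:R * (m%:R * C) * C + 1.
  have TB M N : T (M - N) = T M - T N by rewrite -scaleN1r TD TZ scaleN1r.
  have TBK k : `|(T (X k) - X k) - (T Y - Y)| <= K * `|X k - Y|.
    rewrite (_ : _ - _ = T (X k - Y) - (X k - Y)); last first.
      by rewrite TB opprD addrACA -opprD.
    by rewrite (le_trans (ler_normB _ _))// mulrDl mul1r lerD2r.
  (* [cluster_ge] is one-sided, so each entry is tested with both signs [s]. *)
  have h (s : R) i j : `|s| = 1 -> 0 <= s * (T Y - Y) i j.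
    move=> s1.
    apply: (cluster_ge (f := fun M : 'M[R]_m => s * (T M - M) i j) (K := K) YP) => [k|e e0].
      rewrite -mulrBr normrM s1 mul1r (le_trans _ (TBK k))//.
      by have := mx_norm_entry (T (X k) - X k - (T Y - Y)) i j; rewrite ![in X in _ -> X]mxE; rewrite !mxE.
    pose D := 2 * (m%:R * C * C) + 1.
    have D0 : 0 < D by rewrite /D ltr_wpDl// !mulr_ge0.
    have [N _ NP] := near_infty_natSinv_lt (PosNum (divr_gt0 e0 D0)).
    exists N => k Nk; have /= kD := NP k Nk.
    suff : `|s * (T (X k) - X k) i j| <= e by rewrite ler_norml sub0r => /andP[].
    rewrite normrM s1 mul1r TX mxE normrM ger0_norm ?invr_ge0//.
    apply: (@le_trans _ _ (e / D * D)); last by rewrite divfK ?gt_eqF.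
    rewrite ler_pM ?(ltW kD)// (le_trans (mx_norm_entry _ _ _))//.
    rewrite (le_trans (ler_normB _ _))// /D.
    by have := Q_le k.+1; have := Q_le 0; lra.
  apply/eqP; rewrite -subr_eq0; apply/eqP/matrixP => i j; rewrite [RHS]mxE.
  apply/eqP; rewrite eq_le; apply/andP; split.
    by have := h (-1) i j (normrN1 _); rewrite mulN1r oppr_ge0.
  by have := h 1 i j (normr1 _); rewrite mul1r.
exists Y; split=> // x x0.
pose S (x : 'cV[R]_m) := qform Y x = 0.
have [|c y z Sy Sz|k y Sy|S0|S1] := irreducible_subspace Airr (S := S).
- by rewrite /S /qform mulmx0 mxE.
- have := qform_parallelogram Y (c *: y) z; rewrite qform_scale Sy Sz mulr0 addr0 mulr0.
  by have := Y0 (c *: y + z); have := Y0 (c *: y - z); rewrite /S; lra.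
(* Two nonnegative values with mean [qform Y y = 0] both vanish. *)
- have : 2^-1 * (qform Y (A false *m y) + qform Y (A true *m y)) = 0.
    by rewrite -!qform_mul -qformD -qformZ -/(T Y) YTY Sy.
  have := Y0 (A false *m y); have := Y0 (A true *m y); rewrite /S.
  by case: k; lra.
- rewrite lt_neqAle Y0 andbT eq_sym; apply: contra x0 => /eqP Sx.
  by apply/eqP/S0.
- move: trY; rewrite /mxtrace big1 => [|i _].
    by rewrite leNgt invr_gt0 exprn_gt0// ltr0n.
  have := S1 (delta_mx i 0); rewrite /S /qform trmx_delta -rowE -colE !mxE.
  by [].
Qed.

End Cesaro.

(** In the second case [Y = (S^(-1))^T S^(-1)], so conjugation by [S] turns the invariance of [Y]
    into that of the identity, and [unital_orthogonal] applies. *)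
Lemma decay_or_orthogonal :
  (forall e : R, 0 < e -> exists N, forall n, (N <= n)%N ->
     avg n (fun w => `|wprod A w| ^+ 2 : R^o) <= e) \/
  (exists2 S, S \in unitmx & forall k, orthogonal_mx (mx_conj A S k)).
Proof.
have [[n /avg_decay]|] := pselect (exists n, m%:R ^+ 2 * a n < 1); first by left.
move=> /forallNP age; right.
have {}age n : 1 <= m%:R ^+ 2 * a n by rewrite leNgt; apply/negP/age.
have [Y [YT Ypos YA]] := invariant_mean_form age.
have [S Su SY] := positive_form_cholesky YT Ypos.
exists S => // k.
have YE : Y = (invmx S)^T *m invmx S.
  apply: (row_full_inj (A := S^T)); first by rewrite row_full_unit unitmx_tr.
  apply: (row_free_inj (A := S)); first by rewrite row_free_unit.
  by rewrite SY !mulmxA -trmx_mul mulVmx// trmx1 mul1mx mulVmx.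
apply: (unital_orthogonal (C := m%:R * (m%:R * `|invmx S| * C) * `|S|)) => //.
- exact: irreducible_conj.
- by move=> j; rewrite !unitmx_mul unitmx_inv Su Aunit.
- move=> w; rewrite wprod_conj//.
  rewrite (le_trans (mx_normM _ _))// ler_wpM2r// ler_wpM2l//.
  by rewrite (le_trans (mx_normM _ _))// ler_wpM2l// mulr_ge0.
- have cE b : (mx_conj A S b)^T *m mx_conj A S b = S^T *m ((A b)^T *m Y *m A b) *m S.
    by rewrite YE /mx_conj !trmx_mul !mulmxA.
  rewrite !cE -mulmxDl -mulmxDr.
  move: YA => /(congr1 (GRing.scale 2)); rewrite scalerA mulfV// scale1r => ->.
  by rewrite -scalemxAr -scalemxAl SY.
Qed.

End Dichotomy.

(** * Joint spectral radius and block triangular pairs *)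

Section JointSpectralRadius.
Variables (R : realType) (m : nat) (M : bool -> 'M[R]_m).
Hypothesis m0 : (0 < m)%N.

Let N k : R := \big[Num.max/0]_(w : k.-tuple bool) `|word_mx M w|.

Let N_ge0 k : 0 <= N k.
Proof. by apply: bigmax_ge_id. Qed.

Let N_ge w : `|wprod M w| <= N (size w).
Proof.
have wt : size (rev w) == size w by rewrite size_rev.
have := le_bigmax 0 (fun t : (size w).-tuple bool => `|word_mx M t|) (Tuple wt).
by rewrite word_mxE revK.
Qed.

Let N_le k c : 0 <= c -> (forall w, size w = k -> `|wprod M w| <= c) -> N k <= c.
Proof.
move=> c0 wc; apply/bigmax_leP; split=> // w _; rewrite word_mxE wc//.
by rewrite size_rev size_tuple.
Qed.

Lemma growth_le x y : 0 <= x <= y -> growth M x -> growth M y.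
Proof.
move=> /andP[x0 xy] [C CP]; exists C => w; apply: le_trans (CP w) _.
have C0 : 0 <= C by have := CP [::]; rewrite expr0 mulr1; apply: le_trans.
by rewrite ler_wpM2l// lerXn2r ?nnegrE ?(le_trans x0 xy).
Qed.

(** Cut a word into pieces of length [k]. Each costs at most [y^k], the factor [m] paying for the
    product inequality of the max norm; the remainder goes into [C]. *)
Let growth_of_power k y : (0 < k)%N -> 0 < y -> m%:R * N k <= y ^+ k -> growth M y.
Proof.
move=> k0 y0 Ny; pose C := \sum_(j < k) N j / y ^+ j.
have C0 : 0 <= C by apply: sumr_ge0 => j _; rewrite divr_ge0// exprn_ge0// ltW.
have short w : (size w < k)%N -> `|wprod M w| <= C * y ^+ size w.
  move=> wk; rewrite -ler_pdivrMr ?exprn_gt0//.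
  apply: (@le_trans _ _ (N (size w) / y ^+ size w)).
    by rewrite ler_wpM2r// invr_ge0 exprn_ge0// ltW.
  rewrite /C (bigD1 (Ordinal wk))//= lerDl; apply: sumr_ge0 => j _.
  by rewrite divr_ge0// exprn_ge0// ltW.
exists C => w; elim: {w}(size w) {-2}w (leqnn (size w)) => [|n IH] w wn.
  by apply: short; apply: leq_ltn_trans wn k0.
have [wk|wk] := ltnP (size w) k; first exact: short.
rewrite -{1}(cat_take_drop k w) wprod_cat (le_trans (mx_normM _ _))//.
have tk : size (take k w) = k by rewrite size_take_min; exact/minn_idPl.
have dk : (size (drop k w) <= n)%N by rewrite size_drop; lia.
apply: (@le_trans _ _ (y ^+ k * (C * y ^+ size (drop k w)))).
  rewrite ler_pM ?mulr_ge0//; last exact: IH.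
  by apply: le_trans Ny; rewrite ler_wpM2l// -[X in N X]tk.
by rewrite mulrCA -exprD size_drop subnKC.
Qed.

Let L : R := inf [set x | 0 <= x /\ growth M x].

Let Linf : has_inf [set x | 0 <= x /\ growth M x].
Proof.
split; last by exists 0 => x [].
exists (m%:R * N 1 + 1); split; first by rewrite addr_ge0// mulr_ge0.
by apply: (@growth_of_power 1); rewrite ?expr1 ?ltr_wpDl ?mulr_ge0 ?lerDl.
Qed.

Let L0 : 0 <= L.
Proof. by apply: lb_le_inf => [|x []]; case: Linf. Qed.

Let growth_above q : L < q -> growth M q.
Proof.
move=> Lq; have [|x [x0 gx]] := inf_adherent (_ : 0 < q - L) Linf.
  by rewrite subr_gt0.
by rewrite -/L subrKC => xq; apply: growth_le gx; rewrite x0 ltW.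
Qed.

Let L_le q : 0 <= q -> growth M q -> L <= q.
Proof. by move=> q0 gq; apply: ge_inf => //; case: Linf. Qed.

Let root_le k (x y : R) : (0 < k)%N -> 0 <= x -> 0 <= y ->
  (x `^ (k%:R^-1) <= y) = (x <= y ^+ k).
Proof.
move=> k0 x0 y0; have k1 : k%:R != 0 :> R by rewrite pnatr_eq0 -lt0n.
rewrite -[LHS](ler_pXn2r k0) ?nnegrE ?powR_ge0//; congr (_ <= _).
by rewrite -[LHS]powR_mulrn ?powR_ge0// -powRrM mulVf// powRr1.
Qed.

(** From above, the constant of growth at rate [L + e/2] is absorbed by [(L + e)^k]. From below,
    [N k <= (L - e)^k] at one large [k] would give growth at [L - e/2], below the infimum. *)
Let jsr_cvg : (fun k => N k `^ (k%:R^-1)) @ \oo --> L.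
Proof.
apply/cvgrPdist_le => e e0.
have [C CP] : growth M (L + e / 2) by apply: growth_above; rewrite ltrDl divr_gt0.
have C0 : 0 <= C by have := CP [::]; rewrite expr0 mulr1; apply: le_trans.
have e2 : 0 < e / 2 by rewrite divr_gt0.
have Le2 : 0 < L + e / 2 by rewrite ltr_wpDl.
have Le1 : 0 < L + e by rewrite ltr_wpDl.
have [||K1 KP1] := @expr_small R ((L + e / 2) / (L + e)) (C + 1)^-1.
- rewrite divr_ge0 ?ltW//= ltr_pdivrMr// mul1r ltrD2l; lra.
- by rewrite invr_gt0 ltr_wpDl.
have [K2 KP2] : exists K2, forall k, (K2 <= k)%N -> (0 < k)%N ->
    L - e <= N k `^ (k%:R^-1).
  have [Le|Le] := leP L e.
    by exists 0%N => k _ _; rewrite (@le_trans _ _ 0)// ?powR_ge0// subr_le0.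
  have y0 : 0 < L - e / 2 by lra.
  have [||K2 KP2] := @expr_small R ((L - e) / (L - e / 2)) m%:R^-1.
  - have Le0 : 0 < L - e by rewrite subr_gt0.
    by rewrite divr_ge0 ?ltW//= ltr_pdivrMr// mul1r; lra.
  - by rewrite invr_gt0 ltr0n.
  exists K2 => k kK k0; rewrite leNgt; apply/negP => /ltW.
  rewrite root_le ?subr_ge0 ?(ltW Le)// => Nk.
  suff : L <= L - e / 2 by lra.
  apply: L_le; first exact: ltW.
  apply: (growth_of_power k0) => //.
  have := KP2 k kK; rewrite expr_div_n ler_pdivrMr ?exprn_gt0// ler_pdivlMl ?ltr0n//.
  by apply: le_trans; rewrite ler_wpM2l.
exists (maxn 1 (maxn K1 K2)) => // k /=; rewrite !geq_max => /and3P[k0 kK1 kK2].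
rewrite distrC ler_norml lerBlDr lerBrDr [- e + _]addrC KP2// andTb.
rewrite [e + L]addrC root_le ?(ltW Le1)//.
apply: (@le_trans _ _ (C * (L + e / 2) ^+ k)).
  apply: N_le => [|w wk]; last by rewrite -wk.
  by rewrite mulr_ge0// exprn_ge0// ltW.
have Le : 0 < (L + e) ^+ k by rewrite exprn_gt0// ltr_wpDl.
have := KP1 k kK1; rewrite expr_div_n ler_pdivrMr// => h.
apply: (@le_trans _ _ (C * ((C + 1)^-1 * (L + e) ^+ k))); first by rewrite ler_wpM2l.
rewrite mulrA ler_piMl ?(ltW Le)// ler_pdivrMr ?ltr_wpDl//.
by rewrite mul1r lerDl.
Qed.

(* The limit defining the joint spectral radius exists: it is the infimum L of
   the admissible growth rates. *)
Lemma joint_spectral_radiusP (r : R) : 0 <= r ->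
  joint_spectral_radius M <= r <-> (forall q, r < q -> growth M q).
Proof.
move=> r0; have -> : joint_spectral_radius M = L by exact: cvg_lim jsr_cvg.
split=> [Lr q rq|gr]; first exact: growth_above (le_lt_trans Lr rq).
apply/ler_addgt0Pr => e e0; apply: L_le; first by rewrite addr_ge0// ltW.
by apply: gr; rewrite ltrDl.
Qed.

End JointSpectralRadius.

(** The adapted norm of Rota and Strang: it trades growth with a constant [C] for a bound without
    constant at every single step. *)
Definition is_extremal_gauge (R : realType) m (A : bool -> 'M[R]_m) (q : R)
    (G : 'cV[R]_m -> R) (K : R) :=
  [/\ 0 <= K, forall x y, G (x + y) <= G x + G y,
      forall x, `|x| <= G x <= K * `|x| &
      forall k x, G (A k *m x) <= q * G x].

Lemma extremal_gauge (R : realType) m (A : bool -> 'M[R]_m) q : 0 < q -> growth A q ->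
  exists (G : 'cV[R]_m -> R) (K : R), is_extremal_gauge A q G K.
Proof.
move=> q0 [C CP].
have C0 : 0 <= C by have := CP [::]; rewrite expr0 mulr1; apply: le_trans.
pose E (x : 'cV[R]_m) := [set `|wprod A w *m x| / q ^+ size w | w in [set: seq bool]].
have ub (x : 'cV[R]_m) w : `|wprod A w *m x| / q ^+ size w <= m%:R * C * `|x|.
  rewrite ler_pdivrMr ?exprn_gt0// mulrAC (le_trans (mx_normM _ _))// ler_wpM2r//.
  by rewrite -mulrA ler_wpM2l.
have Esup x : has_sup (E x).
  split; first by exists (`|wprod A [::] *m x| / q ^+ 0); exists [::].
  by exists (m%:R * C * `|x|) => _ [w _ <-].
have sub x w : `|wprod A w *m x| / q ^+ size w <= sup (E x).
  by apply: ub_le_sup; [case: (Esup x)|exists w].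
(* G x = sup_w |A_w x| / q^|w| *)
exists (fun x => sup (E x)), (m%:R * C); split.
- by rewrite mulr_ge0.
- move=> x y; apply: ge_sup => [|_ [w _ <-]]; first by case: (Esup (x + y)).
  apply: le_trans (lerD (sub x w) (sub y w)).
  rewrite -mulrDl ler_wpM2r ?invr_ge0 ?exprn_ge0 ?(ltW q0)// mulmxDr.
  exact: ler_normD.
- move=> x; apply/andP; split; first by have := sub x [::]; rewrite mul1mx divr1.
  by apply: ge_sup => [|_ [w _ <-]]; first by case: (Esup x).
- move=> k x; apply: ge_sup => [|_ [w _ <-]]; first by case: (Esup (A k *m x)).
  have := sub x (rcons w k); rewrite wprod_rcons -mulmxA size_rcons exprS.
  by rewrite invfM mulrCA ler_pdivrMl.
Qed.

(** * Block triangular pairs, by inclusions [b i] and projections [c i] *)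

Section BlockTriangular.
Variables (R : realType) (d s : nat) (p : 'I_s -> nat).
Variables (b : forall i, 'M[R]_(d, p i)) (c : forall i, 'M[R]_(p i, d)).
Variable (M : bool -> 'M[R]_d).
Hypothesis bc : \sum_i b i *m c i = 1%:M.
Hypothesis tri : forall k (i j : 'I_s), (j < i)%N -> c i *m M k *m b j = 0.

Definition diag_block i k : 'M[R]_(p i) := c i *m M k *m b i.

Lemma block_expand n (X : 'M[R]_(d, n)) : X = \sum_i b i *m (c i *m X).
Proof.
by rewrite -{1}[X]mul1mx -bc mulmx_suml; apply: eq_bigr => i _; rewrite mulmxA.
Qed.

Lemma wprod_tri : (forall i j, i != j -> c i *m b j = 0) ->
  forall w (i j : 'I_s), (j < i)%N -> c i *m wprod M w *m b j = 0.
Proof.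
move=> cb; elim=> [|k w IH] i j ji /=.
  by rewrite mulmx1 cb// -val_eqE /= gtn_eqF.
rewrite mulmxA -mulmxA [wprod M w *m _]block_expand mulmx_sumr big1// => l _.
rewrite !mulmxA; have [jl|lj] := ltnP j l.
  by rewrite -2!mulmxA [c l *m _]mulmxA IH// mulmx0.
by rewrite tri ?mul0mx// (leq_ltn_trans lj).
Qed.

(** Of the intermediate blocks [l], those below [i] vanish by triangularity of the first factor and
    those above [i] by triangularity of the remaining product. *)
Lemma wprod_diag_block : (forall i, c i *m b i = 1%:M) ->
  (forall i j, i != j -> c i *m b j = 0) ->
  forall i w, c i *m wprod M w *m b i = wprod (diag_block i) w.
Proof.
move=> cb1 cb i; elim=> [|k w IH] /=; first by rewrite mulmx1 cb1.
rewrite mulmxA -mulmxA [wprod M w *m _]block_expand mulmx_sumr (bigD1 i)//=.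
rewrite big1 => [|l li].
  by rewrite addr0 -IH /diag_block !mulmxA.
rewrite !mulmxA; have [il|il] := ltnP i l.
  by rewrite -2!mulmxA [c l *m _]mulmxA wprod_tri// mulmx0.
by rewrite tri ?mul0mx// ltn_neqAle il andbT.
Qed.

(** A weighted sum of gauges of the diagonal blocks is expanded by at most [q'] in each step; the
    gap [q' - q] pays for the off-diagonal blocks. *)
Lemma block_growth (q q' : R) : 0 < q -> q < q' ->
  (forall i, growth (diag_block i) q) -> growth M q'.
Proof.
move=> q0 qq' gr.
pose G i := projT1 (cid (extremal_gauge q0 (gr i))).
have /choice[K GP] : forall i, exists K, is_extremal_gauge (diag_block i) q (G i) K.
  by move=> i; exact: projT2 (cid (extremal_gauge q0 (gr i))).
have G0 i x : 0 <= G i x.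
  by have [_ _ /(_ x)/andP[+ _] _] := GP i; apply: le_trans.
pose H := \sum_k \sum_i \sum_j K i * ((p j)%:R * `|c i *m M k *m b j|).
have Kge0 i : 0 <= K i by have [] := GP i.
have term_ge0 i j k : 0 <= K i * ((p j)%:R * `|c i *m M k *m b j|).
  by rewrite mulr_ge0// mulr_ge0.
have H0 : 0 <= H by do 3![apply: sumr_ge0 => ? _].
have GH k i j (y : 'cV[R]_(p j)) : G i (c i *m M k *m b j *m y) <= H * G j y.
  have [_ _ /(_ (c i *m M k *m b j *m y))/andP[_ h] _] := GP i.
  apply: le_trans h _.
  have [_ _ /(_ y)/andP[yG _] _] := GP j.
  apply: (@le_trans _ _ (K i * ((p j)%:R * `|c i *m M k *m b j|) * `|y|)).
    by rewrite -mulrA ler_wpM2l// mx_normM.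
  rewrite ler_pM//.
  rewrite /H (bigD1 k)//= (bigD1 i)//= (bigD1 j)//= -!addrA lerDl.
  by rewrite !addr_ge0//; do 3?[apply: sumr_ge0 => ? _].
pose k0 := 1 + s%:R * H / (q' - q).
have qq0 : 0 < q' - q by rewrite subr_gt0.
have k01 : 1 <= k0 by rewrite lerDl divr_ge0 ?mulr_ge0// ltW.
have k00 : 0 < k0 by apply: lt_le_trans k01.
have Hk : s%:R * H / k0 <= q' - q.
  by rewrite ler_pdivrMr// /k0 mulrDr mulr1 [X in _ + X]mulrC divfK ?gt_eqF// lerDr ltW.
(* For k0 large the weights k0^i make the off-diagonal blocks, which map higher
   components to lower ones, contribute at most (q' - q) V. *)
pose V (x : 'cV[R]_d) := \sum_(i < s) k0 ^+ i * G i (c i *m x).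
have V0 x : 0 <= V x by apply: sumr_ge0 => i _; rewrite mulr_ge0// exprn_ge0// ltW.
have Gsum i n (f : 'I_n -> 'cV[R]_(p i)) : G i (\sum_j f j) <= \sum_j G i (f j).
  have [_ GD /(_ 0)/andP[_ G00] _] := GP i.
  elim/big_ind2: _ => // [|x x' y y' h1 h2].
    by apply: le_trans G00 _; rewrite normr0 mulr0.
  by apply: le_trans (GD _ _) _; exact: lerD.
have Vstep k x : V (M k *m x) <= q' * V x.
  have step i : G i (c i *m (M k *m x)) <=
      q * G i (c i *m x) + \sum_(j < s | (i < j)%N) H * G j (c j *m x).
    have -> : c i *m (M k *m x) = \sum_j c i *m M k *m b j *m (c j *m x).
      rewrite {1}[x]block_expand !mulmx_sumr; apply: eq_bigr => j _.
      by rewrite !mulmxA.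
    apply: le_trans (Gsum _ _ _) _.
    rewrite (bigD1 i)//=; apply: lerD.
      by have [_ _ _] := GP i; apply.
    rewrite (bigID (fun j : 'I_s => (i < j)%N))/= [X in _ + X <= _]big1 ?addr0 => [|j].
      rewrite (eq_bigl (fun j : 'I_s => (i < j)%N)) => [|j].
        by apply: ler_sum => j _; exact: GH.
      by rewrite -val_eqE /=; case: ltngtP.
    move=> /andP[ji]; rewrite -leqNgt leq_eqVlt val_eqE (negbTE ji) /= => ji'.
    rewrite tri// mul0mx; have [_ _ /(_ 0)/andP[_ h] _] := GP i.
    by apply/eqP; rewrite eq_le G0 andbT (le_trans h)// normr0 mulr0.
  apply: (@le_trans _ _ (q * V x + s%:R * H / k0 * V x)); last first.
    by rewrite -mulrDl ler_wpM2r//; lra.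
  apply: (@le_trans _ _ (\sum_(i < s) (q * (k0 ^+ i * G i (c i *m x)) + H / k0 * V x))).
    apply: ler_sum => i _.
    apply: (@le_trans _ _ (k0 ^+ i * (q * G i (c i *m x) + \sum_(j < s | (i < j)%N) H * G j (c j *m x)))).
      by rewrite ler_wpM2l// exprn_ge0// ltW.
    rewrite mulrDr mulrCA lerD2l mulr_sumr.
    apply: (@le_trans _ _ (\sum_(j : 'I_s | (i < j)%N) H / k0 * (k0 ^+ j * G j (c j *m x)))).
      apply: ler_sum => j ij.
      rewrite (_ : _ * (H * _) = H * k0 ^+ i * G j (c j *m x)); last by ring.
      rewrite (_ : H / k0 * _ = H * (k0 ^+ j / k0) * G j (c j *m x)); last by ring.
      rewrite ler_wpM2r// ler_wpM2l// ler_pdivlMr// -exprSr.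
      by rewrite ler_weXn2l.
    rewrite -mulr_sumr ler_wpM2l ?divr_ge0 ?(ltW k00)//.
    rewrite /V [leRHS](bigID (fun j : 'I_s => (i < j)%N))/= lerDl.
    by apply: sumr_ge0 => j _; rewrite mulr_ge0// exprn_ge0// ltW.
  rewrite big_split /= -mulr_sumr sumr_const card_ord -[X in _ + X <= _]mulr_natl.
  by rewrite !mulrA lexx.
have Vw w x : V (wprod M w *m x) <= q' ^+ size w * V x.
  elim: w => [|k w IH] /=; first by rewrite mul1mx expr0 mul1r.
  rewrite -mulmxA (le_trans (Vstep _ _))// exprS -mulrA ler_wpM2l//.
  by rewrite ltW// (lt_trans q0).
have q'0 : 0 < q' by apply: lt_trans qq'.
have [x|C _ CP] := @mx_norm_bounded_pointwise R _ _ _ (fun w => q' ^- size w *: wprod M w).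
  pose D := \sum_i (p i)%:R * `|b i|.
  have D0 : 0 <= D by apply: sumr_ge0 => i _; rewrite mulr_ge0.
  exists (D * V x) => w.
  rewrite -scalemxAl normrZ ger0_norm ?invr_ge0 ?exprn_ge0 ?(ltW q'0)//.
  rewrite ler_pdivrMl ?exprn_gt0//.
  apply: (@le_trans _ _ (D * V (wprod M w *m x))); last first.
    by rewrite mulrCA ler_wpM2l.
  rewrite {1}[wprod M w *m x]block_expand (le_trans (ler_norm_sum _ _ _))//.
  rewrite /D mulr_suml; apply: ler_sum => i _.
  rewrite (le_trans (mx_normM _ _))// ler_wpM2l ?mulr_ge0//.
  have [_ _ /(_ (c i *m (wprod M w *m x)))/andP[h _] _] := GP i.
  apply: le_trans h _; rewrite /V (bigD1 i)//=.
  apply: (@le_trans _ _ (k0 ^+ i * G i (c i *m (wprod M w *m x)))).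
    by rewrite ler_peMl// exprn_ege1.
  by rewrite lerDl sumr_ge0// => j _; rewrite mulr_ge0// exprn_ge0// ltW.
exists C => w; have := CP w.
rewrite normrZ ger0_norm ?invr_ge0 ?exprn_ge0 ?(ltW q'0)//.
by rewrite ler_pdivrMl ?exprn_gt0// mulrC.
Qed.

End BlockTriangular.

Section BlockBasis.
Variables (R : realType) (d s : nat) (p : 'I_s -> nat).
Variables (P : 'M[R]_(d, \sum_(i < s) p i)) (Q : 'M[R]_(\sum_(i < s) p i, d)).
Hypotheses (PQ : P *m Q = 1%:M) (QP : Q *m P = 1%:M).

Lemma submxrow_submxcol_sum : \sum_i submxrow P i *m submxcol Q i = 1%:M.
Proof. by rewrite -mul_mxrow_mxcol submxrowK submxcolK. Qed.

Lemma submxcol_mul_submxrow (M : 'M[R]_d) i j :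
  submxblock (Q *m M *m P) i j = submxcol Q i *m M *m submxrow P j.
Proof. by rewrite submxblockEh -mul_submxrow -!submxcol_mul. Qed.

Lemma submxcol_submxrow i j :
  submxcol Q i *m submxrow P j = if i == j then conform_mx 0 (1%:M : 'M[R]_(p i)) else 0.
Proof.
by rewrite -[submxcol Q i]mulmx1 -submxcol_mul_submxrow mulmx1 QP -mxdiagZ mxblockK.
Qed.

Lemma submxcol_submxrow_diag i : submxcol Q i *m submxrow P i = 1%:M.
Proof. by rewrite submxcol_submxrow eqxx conform_mx_id. Qed.

Lemma submxcol_submxrow_off i j : i != j -> submxcol Q i *m submxrow P j = 0.
Proof. by rewrite submxcol_submxrow => /negbTE ->. Qed.

End BlockBasis.

Lemma mulmx1_swap (F : fieldType) m n (A : 'M[F]_(m, n)) (B : 'M[F]_(n, m)) :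
  n = m -> A *m B = 1%:M -> B *m A = 1%:M.
Proof. by move=> nm; case: m / nm A B => A B; exact: mulmx1C. Qed.

Lemma unitmx_inj (F : fieldType) m (A : 'M[F]_m) :
  (forall x : 'cV[F]_m, A *m x = 0 -> x = 0) -> A \in unitmx.
Proof.
move=> AI; rewrite -unitmx_tr -row_free_unit -kermx_eq0.
apply/eqP/row_matrixP => i; rewrite row0; apply: trmx_inj; rewrite trmx0.
apply: AI; apply: trmx_inj; rewrite trmx_mul trmxK trmx0.
by rewrite -row_mul mulmx_ker row0.
Qed.

Lemma mulmx_eq0P (F : fieldType) m n (A : 'M[F]_(m, n)) :
  (forall x : 'cV[F]_n, A *m x = 0) -> A = 0.
Proof.
move=> A0; apply/matrixP => i j; rewrite mxE.
by have := A0 (delta_mx j 0) => /matrixP/(_ i 0); rewrite -colE !mxE.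
Qed.

Lemma mulmx_right_inverse (F : fieldType) m n (A : 'M[F]_(m, n)) :
  (forall x : 'cV[F]_m, exists z : 'cV[F]_n, A *m z = x) ->
  exists B : 'M[F]_(n, m), A *m B = 1%:M.
Proof.
move=> AS; have /choice[z zP] := fun j => AS (delta_mx j 0).
exists (\matrix_(k, j) z j k 0); apply/matrixP => i j.
have := zP j => /matrixP/(_ i 0); rewrite !mxE eqxx andbT => <-.
by apply: eq_bigr => k _; rewrite mxE.
Qed.

(** * Composition series and adapted bases *)

Section CompositionSeries.
Variables (R : realType) (d : nat) (M : bool -> 'M[R]_d).

Let V := 'cV[R]_d.

Definition mx_stable (U : {vspace V}) := forall k (x : V), x \in U -> M k *m x \in U.

Definition next_stable (U U' : {vspace V}) :=
  [/\ mx_stable U', (U <= U')%VS, (\dim U < \dim U')%N &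
      forall W, mx_stable W -> (U <= W)%VS -> (W <= U')%VS -> W = U \/ W = U'].

(** Least dimension among the stable subspaces strictly above [U] excludes any in between. *)
Lemma next_stable_exists U : U != fullv -> exists U', next_stable U U'.
Proof.
move=> Uf.
pose Pd n := `[< exists2 U', \dim U' = n & [/\ mx_stable U', (U <= U')%VS & (\dim U < \dim U')%N] >].
have exP : exists n, Pd n.
  exists (\dim {:V}); apply/asboolP; exists fullv => //; split.
  - by move=> k x _; exact: memvf.
  - exact: subvf.
  - by rewrite ltn_neqAle (dimv_leqif_eq (subvf U)) Uf dimvS// subvf.
case: (ex_minnP exP) => n /asboolP[U' U'n [U'M UU' dU]] nmin.
exists U'; split=> // W WM UW WU'.
have [WU|WU] := eqVneq W U; first by left.
right; apply/eqP; rewrite eqEdim WU' U'n; apply: nmin; apply/asboolP.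
exists W => //; split=> //.
by rewrite ltn_neqAle (dimv_leqif_eq UW) eq_sym WU dimvS.
Qed.

(** The columns of [P] run through bases of complements [W n] of [F n] in [F n.+1], so [F n] is
    where all coordinates in blocks from [n] on vanish. Stability of [F n] gives triangularity;
    minimality of [F n.+1] gives irreducibility of block [n]. *)
Lemma composition_series :
  exists (s : nat) (p : 'I_s -> nat)
         (P : 'M[R]_(d, \sum_(i < s) p i)) (Q : 'M[R]_(\sum_(i < s) p i, d)),
  [/\ P *m Q = 1%:M /\ Q *m P = 1%:M, forall i, (0 < p i)%N,
      forall k (i j : 'I_s), (j < i)%N -> submxcol Q i *m M k *m submxrow P j = 0,
      forall i, mx_irreducible_pair (diag_block (submxrow P) (submxcol Q) M i) &
      forall k, M k \in unitmx ->
        forall i, diag_block (submxrow P) (submxcol Q) M i k \in unitmx].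
Proof.
have /choice[f fP] U : exists U', U != fullv -> next_stable U U'.
  by have [->|/next_stable_exists[U' U'P]] := eqVneq U fullv; [exists U|exists U'].
pose F n : {vspace V} := iter n f 0%VS.
have Fn n : F n != fullv -> next_stable (F n) (F n.+1) by exact: fP.
pose Pf n := F n == fullv.
have exs : exists n, Pf n.
  (* As long as the chain stays proper the dimension of [F n] is at least [n], which cannot last. *)
  apply: contrapT => /forallNP nf.
  have dF n : (n <= \dim (F n))%N.
    elim: n => [//|n IH]; have [_ _ h _] := Fn n (introN idP (nf n)).
    exact: leq_ltn_trans IH h.
  by have := leq_trans (dF (\dim {:V}).+1) (dimvS (subvf _)); rewrite ltnn.
case: (ex_minnP exs) => s /eqP Fs smin.
have {}Fn n : (n < s)%N -> next_stable (F n) (F n.+1).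
  by move=> ns; apply: Fn; apply: contraL ns => /smin; rewrite -leqNgt.
have Fstab n : (n <= s)%N -> mx_stable (F n).
  case: n => [_|n ns]; last by have [] := Fn n ns.
  by move=> k x; rewrite !memv0 => /eqP ->; rewrite mulmx0.
have FS n : (n < s)%N -> (F n <= F n.+1)%VS by move=> ns; have [] := Fn n ns.
have Fmono n k : (n <= k)%N -> (k <= s)%N -> (F n <= F k)%VS.
  elim: k => [|k IH]; first by rewrite leqn0 => /eqP ->.
  rewrite leq_eqVlt => /orP[/eqP -> //|nk] ks.
  exact: subv_trans (IH nk (ltnW ks)) (FS k ks).
pose W n := (F n.+1 :\: F n)%VS.
have FW n : (n <= s)%N -> F n = (\sum_(i < n) W i)%VS.
  elim: n => [|n IH] ns; first by rewrite big_ord0.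
  rewrite big_ord_recr /= -IH ?(ltnW ns)// addvC /W addv_diff.
  by apply/esym/addv_idPl; exact: FS.
have dW n : (n <= s)%N -> (\sum_(i < n) \dim (W i))%N = \dim (F n).
  elim: n => [|n IH] ns; first by rewrite big_ord0 dimv0.
  rewrite big_ord_recr /= IH ?(ltnW ns)// -(dimv_cap_compl (F n.+1) (F n)).
  by congr (\dim _ + _)%N; apply/esym/capv_idPr; exact: FS.
pose bm n : 'M[R]_(d, \dim (W n)) := \matrix_(k, l) ((vbasis (W n))`_l : V) k 0.
have bmE n y : bm n *m y = \sum_l y l 0 *: (vbasis (W n))`_l.
  apply/matrixP => k l; rewrite ord1 !mxE summxE; apply: eq_bigr => j _.
  by rewrite !mxE mulrC.
have bm_mem n y : bm n *m y \in W n.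
  rewrite bmE memv_suml// => l _; rewrite memvZ// vbasis_mem// mem_nth//.
  by rewrite size_tuple.
have bm_surj n x : x \in W n -> exists y, x = bm n *m y.
  move=> xW; exists (\col_l coord (vbasis (W n)) l x).
  by rewrite bmE {1}(coord_vbasis xW); apply: eq_bigr => l _; rewrite mxE.
pose P : 'M[R]_(d, \sum_(i < s) \dim (W i)) := \mxrow_(i < s) bm i.
have Pb (i : 'I_s) : submxrow P i = bm i by rewrite mxrowK.
have [Q PQ] : exists Q, P *m Q = 1%:M.
  apply: mulmx_right_inverse => x.
  have : x \in (\sum_(i < s) W i)%VS by rewrite -FW// Fs memvf.
  move=> /memv_sumP[u uW ->].
  pose y (i : 'I_s) := projT1 (cid (bm_surj _ _ (uW i isT))).
  exists (\mxcol_i y i); rewrite mul_mxrow_mxcol; apply: eq_bigr => i _.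
  by rewrite /y; case: cid.
have QP : Q *m P = 1%:M.
  apply: mulmx1_swap PQ.
  by rewrite dW// Fs dimvf dim_matrix; exact: muln1.
exists s, (fun i => \dim (W i)), P, Q.
set b := submxrow P; set c := submxcol Q.
have cb1 i : c i *m b i = 1%:M by exact: submxcol_submxrow_diag.
have cb i j : i != j -> c i *m b j = 0 by exact: submxcol_submxrow_off.
have bc : \sum_i b i *m c i = 1%:M by exact: submxrow_submxcol_sum.
have memF n (x : V) : (n <= s)%N ->
    x \in F n <-> forall j : 'I_s, (n <= j)%N -> c j *m x = 0.
  move=> ns; split=> [|cx].
    rewrite FW// => /memv_sumP[u uW ->] j nj.
    rewrite mulmx_sumr big1// => i _.
    have [y ->] := bm_surj _ _ (uW i isT).
    have ji : j != widen_ord ns i by rewrite -val_eqE /= gtn_eqF// (leq_trans (ltn_ord i)).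
    by rewrite mulmxA; have := cb _ _ ji; rewrite /b Pb /= => ->; rewrite mul0mx.
  rewrite [x](block_expand bc) memv_suml// => i _.
  have [ni|ni] := leqP n i; first by rewrite cx// mulmx0 mem0v.
  rewrite /b Pb; apply: subvP (bm_mem _ _).
  exact: subv_trans (diffvSl _ _) (Fmono _ _ ni ns).
have bF i y : b i *m y \in F i.+1.
  by rewrite /b Pb; apply: subvP (bm_mem _ _); exact: diffvSl.
have tri k (i j : 'I_s) : (j < i)%N -> c i *m M k *m b j = 0.
  move=> ji; apply: mulmx_eq0P => y; rewrite -!mulmxA.
  by have /(memF j.+1) := Fstab _ (ltn_ord j) k _ (bF j y); apply.
(* Modulo [F i], the matrix acts on the range of [b i] through the diagonal block. *)
have diagF k i y : M k *m (b i *m y) - b i *m (diag_block b c M i k *m y) \in F i.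
  apply/memF => [|j ij]; first exact: ltnW.
  rewrite mulmxBr !mulmxA; move: ij; rewrite leq_eqVlt => /orP[/eqP/val_inj <-|ij].
    by rewrite cb1 mul1mx subrr.
  by rewrite tri// cb ?mul0mx ?subr0// -val_eqE /= gtn_eqF.
have cF (i : 'I_s) x : x \in F i -> c i *m x = 0.
  by move=> /memF; apply=> //; exact: ltnW.
split=> //.
- move=> i; rewrite lt0n; apply/eqP => Wi0; have [_ _ + _] := Fn i (ltn_ord i).
  rewrite -(dimv_cap_compl (F i.+1) (F i)) -/(W i) Wi0 addn0.
  by rewrite ltnNge dimvS// capvSr.
- move=> i X XM.
  pose g := linfun (mulmx (b i) : 'cV[R]_(\dim (W i)) -> V).
  have gE y : g y = b i *m y by rewrite lfunE.
  have [_ _ _ Fmin] := Fn i (ltn_ord i).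
  (* A subspace [X] stable under the block lifts to a stable subspace between [F i] and [F i.+1]. *)
  have [||| WF|WF] := Fmin (F i + g @: X)%VS.
  + move=> k _ /memv_addP[u uF [_ /memv_imgP[x xX ->] ->]].
    rewrite gE mulmxDr -[M k *m (b i *m x)](subrK (b i *m (diag_block b c M i k *m x))).
    rewrite addrA; apply: memv_add; last by rewrite -gE memv_img// XM.
    by apply: memvD => //; exact: (Fstab _ (ltnW (ltn_ord i))).
  + exact: addvSl.
  + rewrite subv_add FS//=; apply/subvP => _ /memv_imgP[x _ ->].
    by rewrite gE bF.
  + left; apply/eqP; rewrite -subv0; apply/subvP => x xX; rewrite memv0.
    have : g x \in F i by rewrite -WF; apply: (subvP (addvSr _ _)); exact: memv_img.
    by move=> /cF; rewrite gE mulmxA cb1 mul1mx => ->.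
  + right; apply/vspaceP => y; rewrite memvf.
    have := bF i y; rewrite -WF => /memv_addP[u uF [_ /memv_imgP[x xX ->]]].
    move=> /(congr1 (mulmx (c i))); rewrite gE mulmxDr !mulmxA cb1 !mul1mx.
    by rewrite cF// add0r => ->.
(* A kernel vector [y] of the block has [M k (b i y)] in [F i]; since [M k] is injective and
   preserves [F i], already [b i y] lies in [F i], so [y = 0]. *)
- move=> k Mu i; apply: unitmx_inj => y Dy.
  have := diagF k i y; rewrite Dy mulmx0 subr0 => MF.
  pose g := linfun (mulmx (M k) : V -> V).
  have gI : injective g.
    by move=> x x'; rewrite !lfunE /= => /(congr1 (mulmx (invmx (M k)))); rewrite !mulKmx.
  have : b i *m y \in F i.
    apply: (stable_vspace_inj gI) => [x xF|]; last by rewrite lfunE.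
    by rewrite lfunE /=; apply: (Fstab _ (ltnW (ltn_ord i))).
  by move=> /cF; rewrite mulmxA cb1 mul1mx.
Qed.

End CompositionSeries.

(** * Uniform growth from growth along every infinite word *)

(** Koenig's lemma for the binary tree. A [bad] node has good-free extensions of every length;
    without a uniform depth the root is bad and bad nodes continue to an infinite branch that never
    becomes good. *)
Lemma konig_bar (good : seq bool -> Prop) :
  (forall e : nat -> bool, exists k, good (mkseq e k)) ->
  exists n, forall w, size w = n -> exists2 k, (k <= n)%N & good (take k w).
Proof.
move=> ge.
pose bad u := forall n, exists2 w, size w = n & forall k, (k <= size (u ++ w))%N ->
  ~ good (take k (u ++ w)).
apply: contrapT => /forallNP ng.
have bad0 : bad [::].
  move=> n; have /existsNP[w /not_implyP[wn wP]] := ng n.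
  by exists w => // k; rewrite cat0s wn => kn gk; apply: wP; exists k.
have badS u : exists b, bad u -> bad (rcons u b).
  have [b0|/existsNP[n0 N0]] := pselect (bad (rcons u false)); first by exists false.
  exists true => bu n1; apply: contrapT => N1.
  (* If the children failed to be bad at lengths [n0] and [n1], a good-free extension of [u] by one
     more letter than both would pass through one of them and, truncated, contradict its failure. *)
  have [[|b w] // [wn] wP] := bu (maxn n0 n1).+1.
  have e c m : (m <= size w)%N -> forall k, (k <= size (rcons u c ++ take m w))%N ->
      take k (rcons u c ++ take m w) = take k (u ++ c :: w).
    move=> mw k kl; rewrite -cat_rcons -[in RHS](cat_take_drop m w) catA.
    by rewrite [RHS]takel_cat.
  have lek c m : (m <= size w)%N -> forall k, (k <= size (rcons u c ++ take m w))%N ->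
      (k <= size (u ++ c :: w))%N.
    by move=> mw k; rewrite !size_cat size_rcons size_take_min /=; lia.
  case: b wP => wP.
    have m1 : (n1 <= size w)%N by rewrite wn leq_maxr.
    apply: N1; exists (take n1 w); first by rewrite size_take_min; lia.
    by move=> k kl; rewrite e//; apply: wP; exact: lek m1 k kl.
  have m0 : (n0 <= size w)%N by rewrite wn leq_maxl.
  apply: N0; exists (take n0 w); first by rewrite size_take_min; lia.
  by move=> k kl; rewrite e//; apply: wP; exact: lek m0 k kl.
have /choice[f fP] := badS.
pose U := fix U n := if n is k.+1 then rcons (U k) (f (U k)) else [::].
have UE n : mkseq (fun i => f (U i)) n = U n.
  by elim: n => //= n IH; rewrite mkseqS IH.
have Ubad n : bad (U n) by elim: n => //= n IH; exact: fP.
have [k] := ge (fun i => f (U i)); rewrite UE => gk.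
have [[|//] _ /(_ (size (U k)))] := Ubad k 0%N.
by rewrite cats0 take_size leqnn => /(_ isT).
Qed.

Section WordGrowth.
Variables (R : realType) (m : nat) (A : bool -> 'M[R]_m).

Lemma norm_mx1_le1 n : `|1%:M : 'M[R]_n| <= 1.
Proof.
by apply: mx_norm_leP => // i j; rewrite mxE; case: (_ == _); rewrite ?normr1 ?normr0.
Qed.

Lemma wprod_trivial_bound : exists2 K, 1 <= K & forall w, `|wprod A w| <= K ^+ size w.
Proof.
pose K : R := 1 + m%:R * (`|A false| + `|A true|).
have K1 : 1 <= K by rewrite lerDl mulr_ge0// addr_ge0.
have K0 : 0 <= K by apply: le_trans K1.
exists K => //; elim=> [|b w IH]; first exact: norm_mx1_le1.
rewrite /= (le_trans (mx_normM _ _))// exprS ler_pM ?mulr_ge0//.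
rewrite /K ler_wpDl// ler_wpM2l//.
by case: b; rewrite ?lerDl ?lerDr.
Qed.

Lemma wprod_scale a w : wprod (fun k => a *: A k) w = a ^+ size w *: wprod A w.
Proof.
elim: w => [|b w IH] /=; first by rewrite expr0 scale1r.
by rewrite IH -scalemxAl -scalemxAr scalerA exprS.
Qed.

Lemma growth_scale a q : 0 < a -> growth A q -> growth (fun k => a *: A k) (a * q).
Proof.
move=> a0 [C CP]; exists C => w.
rewrite wprod_scale normrZ ger0_norm ?exprn_ge0 ?(ltW a0)// exprMn mulrCA.
by rewrite ler_wpM2l ?exprn_ge0// ltW.
Qed.

Hypothesis m0 : (0 < m)%N.

Lemma norm_mx1 : `|1%:M : 'M[R]_m| = 1.
Proof.
apply/eqP; rewrite eq_le norm_mx1_le1/=.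
have := mx_norm_entry (1%:M : 'M[R]_m) (Ordinal m0) (Ordinal m0).
by rewrite mxE eqxx normr1.
Qed.

(** By [konig_bar] every long word starts with a prefix of length [k <= n] contributing a factor
    1/2, which is at most [q^k] when [q^n = 1/2]. Peel such prefixes off one by one. *)
Lemma uniform_decay :
  (forall e : nat -> bool, exists k, m%:R * `|wprod A (mkseq e k)| <= 2^-1) ->
  exists2 q, 0 < q < 1 & growth A q.
Proof.
move=> bar; have [n nP] := @konig_bar (fun w => m%:R * `|wprod A w| <= 2^-1) bar.
(* The empty word is not good, so each peeling shortens the word. *)
have ng w : m%:R * `|wprod A w| <= 2^-1 -> (0 < size w)%N.
  case: w => //; rewrite norm_mx1 mulr1 => m2.
  have : 1 <= m%:R :> R by rewrite ler1n.
  by lra.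
have n0 : (0 < n)%N.
  have [k kn /ng] := nP (nseq n true) (size_nseq _ _).
  by rewrite size_take_min size_nseq; lia.
have [K K1 KP] := wprod_trivial_bound.
pose q : R := 2^-1 `^ (n%:R^-1).
have nR : n%:R != 0 :> R by rewrite pnatr_eq0 -lt0n.
have qn : q ^+ n = 2^-1.
  by rewrite /q -powR_mulrn ?powR_ge0// -powRrM mulVf// powRr1.
have q0 : 0 < q by rewrite powR_gt0.
have q1 : q < 1.
  rewrite ltNge; apply/negP => q1; have := exprn_ege1 n q1.
  by rewrite qn; lra.
have qk k : (k <= n)%N -> 2^-1 <= q ^+ k.
  by move=> kn; rewrite -qn ler_wiXn2l// ltW.
exists q; first by rewrite q0.
(* [K^n] bounds the products of at most [n] factors, and 2 compensates for [q^k >= 1/2]. *)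
exists (2 * K ^+ n) => w.
have C0 : 0 <= 2 * K ^+ n by rewrite mulr_ge0// exprn_ge0// (le_trans _ K1).
elim: {w}(size w) {-2}w (leqnn (size w)) => [|l IH] w wl.
  move: wl; rewrite leqn0 size_eq0 => /eqP ->; rewrite norm_mx1 expr0 mulr1.
  by have := exprn_ege1 n K1; lra.
have [wn|wn] := leqP (size w) n.
  apply: le_trans (KP w) _; have := qk _ wn.
  have := ler_weXn2l K1 wn; have : 0 <= K ^+ n by rewrite exprn_ge0// (le_trans _ K1).
  by set x := K ^+ n; set y := q ^+ _; nra.
have [k kn gk] : exists2 k, (k <= n)%N & m%:R * `|wprod A (take k w)| <= 2^-1.
  have [|k kn] := nP (take n w); first by rewrite size_take wn.
  by rewrite take_takel//; exists k.
have k0 := ng _ gk; rewrite size_take_min in k0.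
have tk : size (take k w) = k by rewrite size_take_min; lia.
rewrite -{1}(cat_take_drop k w) wprod_cat (le_trans (mx_normM _ _))//.
apply: (@le_trans _ _ (q ^+ k * (2 * K ^+ n * q ^+ size (drop k w)))).
  rewrite ler_pM ?mulr_ge0//; first exact: le_trans gk (qk _ kn).
  by apply: IH; rewrite size_drop; lia.
by rewrite mulrCA -exprD size_drop subnKC//; lia.
Qed.

End WordGrowth.

Lemma uniform_growth (R : realType) m (A : bool -> 'M[R]_m) (q : R) :
  (0 < m)%N -> 0 < q ->
  (forall e : nat -> bool, exists k, m%:R * `|wprod A (mkseq e k)| <= q ^+ k / 2) ->
  growth A q.
Proof.
move=> m0 q0 H; have qV : 0 < q^-1 by rewrite invr_gt0.
have [|x /andP[x0 x1]] := @uniform_decay _ _ (fun k => q^-1 *: A k) m0.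
  move=> e; have [k kP] := H e; exists k.
  rewrite wprod_scale normrZ size_mkseq ger0_norm ?exprn_ge0 ?(ltW qV)//.
  by rewrite mulrCA exprVn ler_pdivrMl ?exprn_gt0.
move=> /(growth_scale q0) [C CP]; exists C => w; have := CP w.
have -> : wprod (fun k => q *: (q^-1 *: A k)) w = wprod A w.
  congr wprod; apply/funext => k; rewrite scalerA mulfV ?gt_eqF// scale1r//.
move=> h; apply: le_trans h _.
have C0 : 0 <= C by have := CP [::]; rewrite expr0 mulr1; apply: le_trans.
by rewrite ler_wpM2l// lerXn2r ?nnegrE ?mulr_ge0 ?(ltW q0) ?(ltW x0)// ler_piMr// ltW.
Qed.

Lemma exprn_powR (R : realType) (x a : R) n : 0 <= x -> (x ^+ n) `^ a = (x `^ a) ^+ n.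
Proof.
move=> x0; rewrite -[x ^+ n]powR_mulrn// -[RHS]powR_mulrn ?powR_ge0//.
by rewrite -!powRrM mulrC.
Qed.

Lemma geometric_scale (R : realType) (theta x : R) : 0 < theta < 1 -> 0 < x <= 1 ->
  exists k, theta ^+ k.+1 < x <= theta ^+ k.
Proof.
move=> /andP[t0 t1] /andP[x0 x1].
have exk : exists k, theta ^+ k.+1 < x.
  have [||N NP] := @expr_small R theta (x / 2).
  - by rewrite t1 ltW.
  - by rewrite divr_gt0.
  by exists N; have := NP N.+1 (leqnSn _); lra.
case: (ex_minnP exk) => k kx kmin; exists k; rewrite kx /=.
case: k kx kmin => [//|k] _ kmin; rewrite leNgt; apply/negP => /kmin.
by rewrite ltnn.
Qed.

(** An increment between two consecutive scales [eta theta^n] loses at most a factor [theta^a]; one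
    beyond [eta] is covered by the trivial bound [K]. For the curve, [adm] selects the increments
    that stay in [[0, 1]]. *)
Lemma holder_of_scales (R : realType) (adm : R -> Prop) (g : R -> R) (theta eta a K : R) :
  0 < theta < 1 -> 0 < eta -> 0 < a -> 0 <= K -> g 0 = 0 ->
  (forall h, adm h -> g h <= K) ->
  (forall n h, adm h -> `|h| <= eta * theta ^+ n -> g h <= K * (theta `^ a) ^+ n) ->
  exists C, forall h, adm h -> g h <= C * `|h| `^ a.
Proof.
move=> /andP[t0 t1] eta0 a0 K0 g0 gK gn.
have q0 : 0 < theta `^ a by rewrite powR_gt0.
have ea0 : 0 < eta `^ a by rewrite powR_gt0.
exists (K / (eta `^ a * theta `^ a) + K / eta `^ a) => h ah.
have C1 : 0 <= K / (eta `^ a * theta `^ a) by rewrite divr_ge0// mulr_ge0// ltW.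
have C2 : 0 <= K / eta `^ a by rewrite divr_ge0// ltW.
have [->|h0] := eqVneq h 0; first by rewrite g0 mulr_ge0 ?powR_ge0// addr_ge0.
have hp : 0 < `|h| by rewrite normr_gt0.
have [he|he] := leP `|h| eta.
  have [||k /andP[k1 k2]] := @geometric_scale R theta (`|h| / eta).
  - by rewrite t0.
  - by rewrite divr_gt0//= ler_pdivrMr// mul1r.
  have gh : g h <= K * (theta `^ a) ^+ k by apply: gn => //; rewrite mulrC -ler_pdivrMr.
  rewrite mulrDl ler_wpDr ?(mulr_ge0 C2 (powR_ge0 _ _))//.
  apply: le_trans gh _.
  have h2 : eta `^ a * (theta `^ a * (theta `^ a) ^+ k) <= `|h| `^ a.
    rewrite -exprS -[(_ `^ _) ^+ _]powR_mulrn ?powR_ge0// -powRrM [a * _]mulrC powRrM.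
    rewrite powR_mulrn ?(ltW t0)// -powRM ?exprn_ge0 ?(ltW t0) ?(ltW eta0)//.
    rewrite ge0_ler_powR ?nnegrE ?mulr_ge0 ?exprn_ge0 ?(ltW a0) ?(ltW t0) ?(ltW eta0)//.
    by rewrite mulrC -ler_pdivlMr// ltW.
  by rewrite -[leRHS]mulrA ler_wpM2l// ler_pdivlMl ?mulr_gt0// -mulrA.
rewrite mulrDl ler_wpDl ?(mulr_ge0 C1 (powR_ge0 _ _))//.
apply: le_trans (gK h ah) _; rewrite -mulrA ler_peMr// ler_pdivlMl// mulr1.
by rewrite ge0_ler_powR ?nnegrE ?(ltW a0) ?(ltW eta0) ?(ltW he).
Qed.

(** * Fractal curves *)

Section Zoom.
Variable R : realType.

(** The point at relative position [s] in the dyadic interval with binary digits [w]. *)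
Fixpoint zoom (w : seq bool) (s : R) : R :=
  if w is b :: w' then ((b : nat)%:R + zoom w' s) / 2 else s.

Lemma zoom_cat u w s : zoom (u ++ w) s = zoom u (zoom w s).
Proof. by elim: u => //= b u ->. Qed.

Lemma zoom_diff w s s' : zoom w s - zoom w s' = (s - s') * 2^-1 ^+ size w.
Proof.
elim: w => [|b w IH] /=; first by rewrite expr0 mulr1.
by rewrite exprS mulrCA -IH; field.
Qed.

Lemma zoom_itv w s : 0 <= s <= 1 -> 0 <= zoom w s <= 1.
Proof.
move=> s01; elim: w => [//|b w /=]; move: (zoom w s) => z /andP[z0 z1].
by case: b => /=; apply/andP; split; lra.
Qed.

Lemma zoom_nseq_false n s : zoom (nseq n false) s = s * 2^-1 ^+ n.
Proof. by elim: n => [|n /= ->]; rewrite ?expr0 ?mulr1// exprS; field. Qed.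

Lemma zoom_nseq_true n s : 1 - zoom (nseq n true) s = (1 - s) * 2^-1 ^+ n.
Proof.
elim: n => [|n IH] /=; first by rewrite expr0 mulr1.
by rewrite exprS mulrCA -IH; field.
Qed.

Lemma half_powR (a : R) : 2^-1 `^ a = 2 `^ (- a).
Proof. by rewrite -[2^-1]powR_inv1// -powRrM mulN1r. Qed.

Lemma ltr_pow2 (x y : R) : (2 `^ x < 2 `^ y) = (x < y).
Proof. by rewrite /powR pnatr_eq0 /= ltr_expR ltr_pM2r// ln_gt0// ltr1n. Qed.

Lemma ler_pow2 (x y : R) : (2 `^ x <= 2 `^ y) = (x <= y).
Proof. by rewrite !leNgt ltr_pow2. Qed.

Lemma half_expr_gt0 n : 0 < 2^-1 ^+ n :> R.
Proof. by rewrite exprn_gt0. Qed.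

Lemma zoom_exists k t : 0 <= t <= 1 ->
  exists w s, [/\ size w = k, 0 <= s <= 1 & t = zoom w s].
Proof.
elim: k t => [|k IH] t t01; first by exists [::], t.
have [t2|t2] := leP t 2^-1.
  have [|w [s [wk s01 E]]] := IH (2 * t); first by apply/andP; split; lra.
  by exists (false :: w), s; split; rewrite /= ?wk// -E; field.
have [|w [s [wk s01 E]]] := IH (2 * t - 1); first by apply/andP; split; lra.
by exists (true :: w), s; split; rewrite /= ?wk// -E; field.
Qed.

(** The common point of the nested dyadic intervals is the supremum of their left ends. The relative
    position may be 0 or 1, so a dyadic point serves both of its expansions. *)
Lemma zoom_infinite (e : nat -> bool) : exists2 t, 0 <= t <= 1 &
  forall k, exists2 s, 0 <= s <= 1 & t = zoom (mkseq e k) s.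
Proof.
pose x k := zoom (mkseq e k) 0.
have i01 : 0 <= (0 : R) <= 1 by rewrite lexx ler01.
have xS k l : (k <= l)%N -> x k <= x l <= x k + 2^-1 ^+ k.
  move=> kl; have -> : x l = zoom (mkseq e k) (zoom (drop k (mkseq e l)) 0).
    rewrite -zoom_cat /x; congr zoom; rewrite -{1}(cat_take_drop k (mkseq e l)).
    by congr (_ ++ _); rewrite /mkseq -map_take take_iota (minn_idPl kl).
  have /andP[z0 z1] := zoom_itv (drop k (mkseq e l)) i01.
  move: (zoom _ 0) z0 z1 => z z0 z1.
  have := zoom_diff (mkseq e k) z 0; rewrite size_mkseq subr0 -/(x k) => zd.
  have := half_expr_gt0 k; set c := _ ^+ k in zd *; move=> c0.
  by apply/andP; split; nra.
have xle k l : x l <= x k + 2^-1 ^+ k.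
  have [kl|lk] := leqP k l; first by have /andP[] := xS _ _ kl.
  have /andP[h _] := xS _ _ (ltnW lk); apply: le_trans h _.
  by rewrite lerDl ltW// half_expr_gt0.
pose E := range x.
have Esup : has_sup E.
  by split; [exists (x 0); exists 0%N|exists (x 0 + 2^-1 ^+ 0) => _ [l _ <-]].
have lo k : x k <= sup E by apply: ub_le_sup; [case: Esup|exists k].
have hi k : sup E <= x k + 2^-1 ^+ k.
  by apply: ge_sup => [|_ [l _ <-]]; [case: Esup|].
exists (sup E).
  by have := lo 0; have := hi 0; rewrite /x /= expr0 add0r => -> ->.
move=> k; exists ((sup E - x k) / 2^-1 ^+ k).
  rewrite divr_ge0 ?subr_ge0// ?(ltW (half_expr_gt0 _))//=.
  by rewrite ler_pdivrMr ?half_expr_gt0// mul1r lerBlDl.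
have := zoom_diff (mkseq e k) ((sup E - x k) / 2^-1 ^+ k) 0.
rewrite size_mkseq subr0 divfK ?gt_eqF ?half_expr_gt0// -/(x k) => zd.
by move: zd => /addIr ->.
Qed.

End Zoom.

(** * Oscillation of the curve and matrix growth *)

Section Curve.
Variables (R : realType) (d : nat) (B : bool -> affine_op R d) (v : R -> 'cV[R]_d).
Hypotheses (d0 : (0 < d)%N) (Birr : affine_irreducible B) (Bv : fractal_curve B v).

Let A k := linear_part (B k).

Let i0 : 0 <= (0 : R) <= 1. Proof. by rewrite lexx ler01. Qed.
Let i1 : 0 <= (1 : R) <= 1. Proof. by rewrite lexx ler01. Qed.

Lemma curve_half (b : bool) s : 0 <= s <= 1 -> v (((b : nat)%:R + s) / 2) = B b (v s).
Proof.
case: Bv => _ v0 v1 s01; case: b => /=.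
  rewrite v1; last by apply/andP; split; lra.
  by congr (B true (v _)); field.
rewrite v0; last by apply/andP; split; lra.
by congr (B false (v _)); field.
Qed.

Lemma curve_zoom w s s' : 0 <= s <= 1 -> 0 <= s' <= 1 ->
  v (zoom w s) - v (zoom w s') = wprod A w *m (v s - v s').
Proof.
move=> s01 s01'; elim: w => [|b w IH] /=; first by rewrite mul1mx.
rewrite !curve_half ?zoom_itv// /affine_apply opprD addrACA subrr addr0.
by rewrite -mulmxBr IH mulmxA.
Qed.

Lemma curve_bounded : exists2 D, 0 <= D &
  forall s s', 0 <= s <= 1 -> 0 <= s' <= 1 -> `|v s - v s'| <= D.
Proof.
case: Bv => vc _ _.
have /compact_bounded[M [Mr MP]] : compact (v @` `[0, 1]%classic).
  by apply: continuous_compact => //; exact: segment_compact.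
have vM s : 0 <= s <= 1 -> `|v s| <= M + 1.
  by move=> s01; apply: (MP (M + 1)); rewrite ?ltrDl//; exists s; rewrite /= ?in_itv.
exists (2 * (M + 1)); last first.
  move=> s s' /vM h /vM h'; apply: le_trans (ler_normB _ _) _; lra.
have := vM 0 i0; have := normr_ge0 (v 0); lra.
Qed.

Lemma curve_continuous t : 0 <= t <= 1 -> forall e : R, 0 < e ->
  exists2 eta : R, 0 < eta & forall u, 0 <= u <= 1 -> `|u - t| < eta -> `|v u - v t| <= e.
Proof.
move=> t01 e e0; case: Bv => /subspace_continuousP vc _ _.
have /cvgrPdist_le/(_ e e0) := vc t ltac:(by rewrite /= in_itv).
rewrite /= near_withinE => /nbhs_ballP[eta /= eta0 etaP].
exists eta => // u u01 ut; rewrite distrC; apply: etaP; last by rewrite /= in_itv.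
by rewrite /ball /= distrC.
Qed.

(** The span [W] of the differences is stable under both linear parts, so if it were proper,
    [v 0 + W] would be a common proper invariant plane. *)
Lemma curve_spans (U : {vspace 'cV[R]_d}) :
  (forall s, 0 <= s <= 1 -> v s - v 0 \in U) -> U = fullv.
Proof.
move=> vU0; apply: contrapT => Uf; apply: Birr.
pose S x := forall U : {vspace 'cV[R]_d},
  (forall s, 0 <= s <= 1 -> v s - v 0 \in U) -> x \in U.
have [||W WP] := @subspace_vspace R _ S.
- by move=> V _; exact: mem0v.
- by move=> a x y Sx Sy V VP; rewrite memvD// ?memvZ// ?Sx ?Sy.
have vW s : 0 <= s <= 1 -> v s - v 0 \in W by move=> s01; apply/WP => V; apply.
exists (v 0), W; split.
  have dE : \dim {:'cV[R]_d} = d by rewrite dimvf dim_matrix; exact: muln1.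
  have WU : (W <= U)%VS by apply/subvP => x /WP; apply.
  apply: leq_ltn_trans (dimvS WU) _; rewrite -[X in (_ < X)%N]dE.
  rewrite ltn_neqAle (dimv_leqif_eq (subvf U)) dimvS ?subvf// andbT.
  by apply/eqP.
move=> k x xW.
(* [B k (v 0)] is again on the curve, so the second summand lies in [W]. *)
have -> : B k x - v 0 = A k *m (x - v 0) + (B k (v 0) - v 0).
  rewrite /affine_apply -/(A k) mulmxBr !addrA; congr (_ - _); congr (_ + _).
  by rewrite subrK.
rewrite memvD//; last first.
  by rewrite -curve_half// vW//; case: k; apply/andP; split; rewrite /=; lra.
move: (x - v 0) xW => y /WP Sy; apply/WP => V VP.
pose F := linfun (mulmx (A k) : 'cV[R]_d -> 'cV[R]_d).
have := Sy (F @^-1: V)%VS; rewrite -memv_preim lfunE; apply => s s01.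
rewrite -memv_preim lfunE /=.
have := curve_zoom [:: k] s01 i0; rewrite /= mulmx1 => <-.
have h u : 0 <= u <= 1 -> v (((k : nat)%:R + u) / 2) - v 0 \in V.
  by move=> u01; apply: VP; exact: (zoom_itv [:: k] u01).
have -> x' y' : v x' - v y' = (v x' - v 0) - (v y' - v 0) by rewrite opprB addrA subrK.
by rewrite memvB// h.
Qed.

(** The vectors on which [M] is controlled, uniformly in [M], by its values on the differences form
    a subspace containing them, hence everything. *)
Lemma oscillation_bound : exists2 C, 0 <= C &
  forall (M : 'M[R]_d) beta, (forall s, 0 <= s <= 1 -> `|M *m (v s - v 0)| <= beta) ->
    `|M| <= C * beta.
Proof.
pose S (x : 'cV[R]_d) := exists2 C, 0 <= C &
  forall (M : 'M[R]_d) beta, (forall s, 0 <= s <= 1 -> `|M *m (v s - v 0)| <= beta) ->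
    `|M *m x| <= C * beta.
have [|a x y [C C0 CP] [C' C0' CP']|U UP] := @subspace_vspace R _ S.
- by exists 0 => // M beta _; rewrite mulmx0 normr0 mul0r.
- exists (`|a| * C + C'); first by rewrite addr_ge0// mulr_ge0.
  move=> M beta Mb; rewrite mulmxDr -scalemxAr (le_trans (ler_normD _ _))//.
  by rewrite mulrDl lerD ?CP'// normrZ -mulrA ler_wpM2l// CP.
have Uf : U = fullv.
  apply: curve_spans => s s01; apply/UP; exists 1 => // M beta Mb.
  by rewrite mul1r Mb.
have /choice[C CP] : forall j, exists C, 0 <= C /\
    forall (M : 'M[R]_d) beta, (forall s, 0 <= s <= 1 -> `|M *m (v s - v 0)| <= beta) ->
    `|M *m delta_mx j (0 : 'I_1)| <= C * beta.
  move=> j; have /UP[C C0 CP] : delta_mx j 0 \in U by rewrite Uf memvf.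
  by exists C.
have C0 : 0 <= \sum_j C j by apply: sumr_ge0 => j _; have [] := CP j.
exists (\sum_j C j) => // M beta Mb.
have b0 : 0 <= beta by apply: le_trans (Mb 0 i0).
apply: mx_norm_leP => [|k j]; first exact: mulr_ge0.
have -> : M k j = (M *m delta_mx j (0 : 'I_1)) k 0 by rewrite -colE mxE.
apply: le_trans (mx_norm_entry _ _ _) _.
have [_ /(_ M beta Mb) h] := CP j; apply: le_trans h _.
rewrite ler_wpM2r// (bigD1 j)//= lerDl sumr_ge0// => l _.
by have [] := CP l.
Qed.

Definition holder_at (t a : R) := 0 < a /\ exists C : R, forall h : R,
  0 <= t + h <= 1 -> `|v (t + h) - v t| <= C * `|h| `^ a.

Lemma osc_prefix t w s eps C : 0 <= C ->
  (forall (M : 'M[R]_d) beta, (forall s, 0 <= s <= 1 -> `|M *m (v s - v 0)| <= beta) ->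
    `|M| <= C * beta) ->
  0 <= s <= 1 -> t = zoom w s ->
  (forall u, 0 <= u <= 1 -> `|u - t| <= 2^-1 ^+ size w -> `|v u - v t| <= eps) ->
  `|wprod A w| <= C * (2 * eps).
Proof.
move=> C0 CP s01 tE ve.
have h u : 0 <= u <= 1 -> `|wprod A w *m (v u - v s)| <= eps.
  move=> u01; rewrite -curve_zoom// -tE ve ?zoom_itv//.
  rewrite tE zoom_diff normrM [X in _ * X]ger0_norm ?(ltW (half_expr_gt0 _ _))//.
  rewrite ler_piMl ?(ltW (half_expr_gt0 _ _))// ler_norml; apply/andP; split; lra.
apply: CP => u u01; rewrite -(subrK (v s) (v u)) -addrA mulmxDr.
rewrite (le_trans (ler_normD _ _))// -[v s - _]opprB mulmxN normrN.
by have := h u u01; have := h 0 i0; lra.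
Qed.

Lemma holder_prefix t a : holder_at t a -> exists2 C, 0 <= C & forall w s,
  0 <= s <= 1 -> t = zoom w s -> `|wprod A w| <= C * (2 `^ (- a)) ^+ size w.
Proof.
move=> [a0 [C CP]]; have [K K0 KP] := oscillation_bound.
exists (K * (2 * `|C|)); first by rewrite !mulr_ge0.
move=> w s s01 tE; rewrite -!mulrA; apply: (osc_prefix K0 KP s01 tE) => u u01 ut.
have := CP (u - t); rewrite [t + _]addrC subrK => /(_ u01) h.
apply: le_trans h _; apply: le_trans (_ : `|C| * `|u - t| `^ a <= _).
  by rewrite ler_wpM2r ?powR_ge0// ler_norm.
rewrite ler_wpM2l//; apply: (@le_trans _ _ ((2^-1 ^+ size w) `^ a)).
  by rewrite ge0_ler_powR ?nnegrE ?(ltW a0) ?exprn_ge0.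
by rewrite exprn_powR// half_powR.
Qed.

(** Continuity of [v] makes the products along the digits of each point small; [uniform_decay] turns
    this into a common rate. *)
Lemma growth_lt1 : exists2 q, 0 < q < 1 & growth A q.
Proof.
have [K K0 KP] := oscillation_bound.
apply: uniform_decay => // e; have [t t01 tP] := zoom_infinite R e.
(* Chosen so that [d (K + 1) (2 eps) = 1/2]. *)
pose eps := (4 * d%:R * (K + 1))^-1.
have eps0 : 0 < eps by rewrite invr_gt0 !mulr_gt0 ?ltr0n ?ltr_wpDl.
have [eta eta0 etaP] := curve_continuous t01 eps0.
have [||N NP] := @expr_small R 2^-1 (eta / 2).
- by apply/andP; split; lra.
- by rewrite divr_gt0.
exists N; have [s s01 tE] := tP N.
have h : `|wprod A (mkseq e N)| <= K * (2 * eps).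
  apply: (osc_prefix K0 KP s01 tE) => u u01; rewrite size_mkseq => ut.
  by apply: etaP => //; have := NP N (leqnn _); lra.
apply: (@le_trans _ _ (d%:R * (K * (2 * eps)))); first by rewrite ler_wpM2l.
apply: (@le_trans _ _ (d%:R * ((K + 1) * (2 * eps)))).
  by rewrite ler_wpM2l// ler_wpM2r ?lerDl// mulr_ge0// ltW.
rewrite /eps le_eqVlt; apply/orP; left; apply/eqP; field.
by rewrite !gt_eqF ?ltr0n ?ltr_wpDl.
Qed.

(** The gap [a' - a] absorbs the constant, which depends on the point, along the digits of that
    point; [uniform_growth] then removes the dependence. *)
Lemma holder_growth a : 0 < a ->
  (forall t, 0 <= t <= 1 -> exists2 a', a < a' & holder_at t a') -> growth A (2 `^ (- a)).
Proof.
move=> a0 vH; apply: uniform_growth; rewrite ?powR_gt0// => e.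
have [t t01 tP] := zoom_infinite R e.
have [a' aa' /holder_prefix[C C0 CP]] := vH t t01.
pose x : R := 2 `^ (a - a').
have x1 : x < 1.
  by rewrite /x -[ltRHS](powRr0 2) ltr_pow2 subr_lt0.
have D0 : 0 < 2 * d%:R * (C + 1) by rewrite !mulr_gt0 ?ltr0n ?ltr_wpDl.
have [||N NP] := @expr_small R x (2 * d%:R * (C + 1))^-1.
- by rewrite powR_ge0.
- by rewrite invr_gt0.
exists N; have [s s01 tE] := tP N.
have := CP _ _ s01 tE; rewrite size_mkseq.
have -> : 2 `^ (- a') = 2 `^ (- a) * x.
  rewrite /x -powRD; first by congr (_ `^ _); ring.
  by apply/implyP.
rewrite exprMn => h; have := NP N (leqnn _).
rewrite -div1r ler_pdivlMr// => h2.
have y0 : 0 < (2 `^ (- a)) ^+ N by rewrite exprn_gt0 ?powR_gt0.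
have d1 : 0 <= d%:R :> R by [].
have xN : 0 <= x ^+ N by rewrite exprn_ge0 ?powR_ge0.
apply: (@le_trans _ _ (d%:R * (C * ((2 `^ (- a)) ^+ N * x ^+ N)))).
  by rewrite ler_wpM2l.
apply: (@le_trans _ _ ((2 `^ (- a)) ^+ N * (x ^+ N * (d%:R * (C + 1))))).
  rewrite [leLHS](_ : _ = (2 `^ (- a)) ^+ N * (x ^+ N * (d%:R * C))); last by ring.
  by rewrite !ler_wpM2l// ?(ltW y0)// lerDl.
by rewrite ler_wpM2l ?(ltW y0)//; lra.
Qed.

(** Two close points need not share a short dyadic interval. After their common digits are split
    off, the dyadic point separating them is an end of the curve for each side. *)
Lemma growth_holder a : 0 < a -> growth A (2 `^ (- a)) ->
  forall t, 0 <= t <= 1 -> holder_at t a.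
Proof.
move=> a0 [C CP] t t01; split=> //.
have [D D0 DP] := curve_bounded.
set q := 2 `^ (- a) in CP; have q0 : 0 <= q by exact: powR_ge0.
have C0 : 0 <= C by have := CP [::]; rewrite expr0 mulr1; apply: le_trans.
pose E := d%:R * C * D; have E0 : 0 <= E by rewrite !mulr_ge0.
have word p s s' : 0 <= s <= 1 -> 0 <= s' <= 1 ->
    `|wprod A p *m (v s - v s')| <= E * q ^+ size p.
  move=> s01 s01'; rewrite (le_trans (mx_normM _ _))//.
  rewrite (_ : E * _ = d%:R * (C * q ^+ size p) * D); last by rewrite /E; ring.
  by rewrite ler_pM ?mulr_ge0// ?ler_wpM2l// DP.
have left0 p k u : 0 <= u <= 2^-1 ^+ k ->
    `|wprod A p *m (v u - v 0)| <= E * q ^+ (size p + k).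
  move=> /andP[u0 uk]; have c0 := half_expr_gt0 R k.
  have uE : u = zoom (nseq k false) (u / 2^-1 ^+ k).
    by rewrite zoom_nseq_false divfK// gt_eqF.
  have {1}-> : (0 : R) = zoom (nseq k false) 0 by rewrite zoom_nseq_false mul0r.
  have u01 : 0 <= u / 2^-1 ^+ k <= 1 by rewrite divr_ge0 ?(ltW c0)//= ler_pdivrMr// mul1r.
  rewrite uE curve_zoom// mulmxA -wprod_cat (le_trans (word _ _ _ _ _))//.
  by rewrite size_cat size_nseq.
have right1 p k u : 0 <= 1 - u <= 2^-1 ^+ k ->
    `|wprod A p *m (v 1 - v u)| <= E * q ^+ (size p + k).
  move=> /andP[u0 uk]; have c0 := half_expr_gt0 R k.
  have uE : u = zoom (nseq k true) (1 - (1 - u) / 2^-1 ^+ k).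
    have yc : (1 - u) / 2^-1 ^+ k * 2^-1 ^+ k = 1 - u by rewrite divfK// gt_eqF.
    move: (_ / _) yc => y yc; have := zoom_nseq_true k (1 - y).
    have -> : 1 - (1 - y) = y by ring.
    by rewrite yc => /addrI/oppr_inj ->.
  have {1}-> : (1 : R) = zoom (nseq k true) 1.
    by have := zoom_nseq_true k (1 : R); rewrite subrr mul0r => /subr0_eq.
  have : 0 <= (1 - u) / 2^-1 ^+ k <= 1 by rewrite divr_ge0 ?(ltW c0)//= ler_pdivrMr// mul1r.
  move: (_ / _) uE => z uE /andP[z0 z1].
  have z01 : 0 <= 1 - z <= 1 by apply/andP; split; lra.
  rewrite uE curve_zoom// mulmxA -wprod_cat (le_trans (word _ _ _ _ _))//.
  by rewrite size_cat size_nseq.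
(* Induction on the scale, [p] collecting the common digits: points in one half are zoomed.
   Otherwise 1/2 separates them, and [left0] and [right1] contribute [E] each. *)
have close k : forall p u u', 0 <= u -> u <= u' -> u' <= 1 -> u' - u <= 2^-1 ^+ k ->
    `|wprod A p *m (v u' - v u)| <= 2 * E * q ^+ (size p + k).
  elim: k => [|k IH] p u u' u0 uu' u1 uuk.
    rewrite addn0 (le_trans (word _ _ _ _ _))//; first 2 last.
    - by rewrite -mulrA ler_peMl// ?ler1n// mulr_ge0// exprn_ge0.
    - by apply/andP; split; lra.
    - by apply/andP; split; lra.
  have ck : 2^-1 ^+ k.+1 = 2^-1 * 2^-1 ^+ k :> R by rewrite exprS.
  have step (b : bool) s s' : 0 <= s -> s <= s' -> s' <= 1 -> s' - s <= 2^-1 ^+ k ->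
      `|wprod A p *m (v (((b : nat)%:R + s') / 2) - v (((b : nat)%:R + s) / 2))|
      <= 2 * E * q ^+ (size p + k.+1).
    move=> s0 ss' s1 ssk.
    rewrite -[_ / 2]/(zoom [:: b] s') -[(_ + s) / 2]/(zoom [:: b] s) curve_zoom.
    - rewrite mulmxA -wprod_cat (le_trans (IH _ _ _ _ _ _ _))//.
      by rewrite size_cat addnAC addn1 addnS.
    - by apply/andP; split; lra.
    - by apply/andP; split; lra.
  have [u'2|u'2] := leP u' 2^-1.
    have := step false (2 * u) (2 * u'); rewrite !add0r ![2 * _]mulrC !mulfK//.
    by apply; lra.
  have [u2|u2] := leP 2^-1 u.
    have := step true (2 * u - 1) (2 * u' - 1).
    rewrite ![_ + (_ - 1)]addrC !subrK ![2 * _]mulrC !mulfK//.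
    by apply; lra.
  rewrite -(subrK (v 2^-1) (v u')) -addrA mulmxDr (le_trans (ler_normD _ _))//.
  rewrite -mulrA mulrDl !mul1r.
  have h0 : 2^-1 = zoom [:: true] 0 :> R by rewrite /=; field.
  have h1 : 2^-1 = zoom [:: false] 1 :> R by rewrite /=; field.
  apply: lerD.
    have {1}-> : u' = zoom [:: true] (2 * u' - 1) by rewrite /=; field.
    rewrite h0 curve_zoom//; last by apply/andP; split; lra.
    rewrite mulmxA -wprod_cat (le_trans (left0 _ k _ _))//.
      by apply/andP; split; lra.
    by rewrite size_cat addnAC addn1 addnS.
  have {1}-> : u = zoom [:: false] (2 * u) by rewrite /=; field.
  rewrite h1 curve_zoom//; last by apply/andP; split; lra.
  rewrite mulmxA -wprod_cat (le_trans (right1 _ k _ _))//.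
    by apply/andP; split; lra.
  by rewrite size_cat addnAC addn1 addnS.
apply: (@holder_of_scales R (fun h => 0 <= t + h <= 1)
  (fun h => `|v (t + h) - v t|) 2^-1 1 a (2 * E + D)) => //.
- by apply/andP; split; lra.
- by rewrite addr_ge0// mulr_ge0.
- by rewrite addr0 subrr normr0.
- by move=> h th; rewrite (le_trans (DP _ _ _ _))// lerDr mulr_ge0.
move=> n h th; rewrite mul1r => hn.
have -> : 2^-1 `^ a = q by exact: half_powR.
apply: (@le_trans _ _ (2 * E * q ^+ n)).
  have /andP[th0 th1] := th; have /andP[t0 t1] := t01.
  have [h0|h0] := leP 0 h.
    have := close n [::] t (t + h); rewrite mul1mx; apply => //; first by lra.
    by rewrite [t + h]addrC addrK (le_trans (ler_norm _)).
  have := close n [::] (t + h) t; rewrite mul1mx distrC; apply => //; first by lra.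
  by rewrite opprD addrA subrr add0r (le_trans (ler_norm _))// normrN.
by rewrite ler_wpM2r ?exprn_ge0// lerDl.
Qed.

(** At the fixed point [t] of [zoom w], the maps [zoom (W n)] carry a relative neighbourhood of [t]
    in [[0, 1]] to neighbourhoods of size [theta^n], so the powers of [wprod A w] control the
    regularity from both sides. *)
Lemma periodic_holder w a : (0 < size w)%N -> 0 < a ->
  growth (fun _ : bool => wprod A w) ((2 `^ (- a)) ^+ size w) ->
  exists2 t, 0 <= t <= 1 & holder_at t a.
Proof.
move=> w0 a0 [C CP]; have [D D0 DP] := curve_bounded.
set q := _ ^+ _ in CP; have q0 : 0 <= q by rewrite exprn_ge0// powR_ge0.
have C0 : 0 <= C by have := CP [::]; rewrite expr0 mulr1; apply: le_trans.
pose theta : R := 2^-1 ^+ size w.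
have th0 : 0 < theta by exact: half_expr_gt0.
have th1 : theta < 1 by rewrite exprn_ilt1 ?lt0n_neq0//; lra.
(* The solution of [t = zoom w 0 + theta t]. *)
pose t := zoom w 0 / (1 - theta).
have omt : 0 < 1 - theta by rewrite subr_gt0.
have t01 : 0 <= t <= 1.
  have /andP[z0 _] := zoom_itv w i0; have /andP[_ z1] := zoom_itv w i1.
  rewrite /t divr_ge0 ?(ltW omt)//= ler_pdivrMr// mul1r.
  by have := zoom_diff w (1 : R) 0; rewrite subr0 mul1r -/theta; lra.
have tfix : zoom w t = t.
  have := zoom_diff w t 0; rewrite -/theta subr0 => e.
  have : t * (1 - theta) = zoom w 0 by rewrite divfK ?gt_eqF.
  rewrite mulrBr mulr1 => h; rewrite -[zoom w t](subrK (zoom w 0)) e -h.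
  by rewrite addrC subrK.
exists t => //; split=> //.
pose W n := flatten (nseq n w).
have Wfix n : zoom (W n) t = t.
  by elim: n => [//|n IH]; rewrite /W /= zoom_cat -/(W n) IH.
have Wsize n : 2^-1 ^+ size (W n) = theta ^+ n :> R.
  by elim: n => [//|n IH]; rewrite /W /= size_cat -/(W n) exprD IH exprS.
have WA n : wprod A (W n) = wprod (fun=> wprod A w) (nseq n true).
  by elim: n => [//|n IH]; rewrite /W /= wprod_cat -/(W n) IH.
have WC n s s' : 0 <= s <= 1 -> 0 <= s' <= 1 ->
    `|wprod A (W n) *m (v s - v s')| <= d%:R * C * D * q ^+ n.
  move=> s01 s01'; rewrite (le_trans (mx_normM _ _))//.
  rewrite (_ : _ * q ^+ n = d%:R * (C * q ^+ n) * D); last by ring.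
  rewrite ler_pM ?mulr_ge0// ?ler_wpM2l ?DP//.
  by rewrite WA (le_trans (CP _))// size_nseq.
(* An interior [t] leaves room [t] and [1 - t] for the rescaled increment. At an end of [[0, 1]] the
   sign of [h] is forced, and that side gets the default 1. *)
have [eta eta0 etaP] : exists2 eta, 0 < eta & forall n h, `|h| <= eta * theta ^+ n ->
    0 <= t + h <= 1 -> 0 <= t + h / theta ^+ n <= 1.
  have /andP[t0 t1] := t01.
  pose e0 := if t == 0 then 1 else t; pose e1 := if t == 1 then 1 else 1 - t.
  exists (Num.min e0 e1).
    rewrite lt_min; apply/andP; split.
      by rewrite /e0; case: eqVneq => // tn0; rewrite lt_neqAle eq_sym tn0.
    by rewrite /e1; case: eqVneq => // tn1; rewrite subr_gt0 lt_neqAle tn1.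
  move=> n h; have c0 : 0 < theta ^+ n by rewrite exprn_gt0.
  rewrite -ler_pdivrMr// -[X in `|h| / X]ger0_norm ?(ltW c0)// -normf_div le_min.
  move=> /andP[he0 he1] /andP[h0 h1].
  have hs : h = h / theta ^+ n * theta ^+ n by rewrite divfK// gt_eqF.
  move: (h / _) hs he0 he1 => y hs he0 he1.
  have yn : - `|y| <= y by rewrite lerNl -normrN ler_norm.
  have yp := ler_norm y.
  apply/andP; split.
    move: he0; rewrite /e0; case: eqVneq => [t00 _|_ yt]; last by lra.
    rewrite t00 add0r; move: h0; rewrite t00 add0r hs pmulr_lge0//.
  move: he1; rewrite /e1; case: eqVneq => [t11 _|_ yt]; last by lra.
  rewrite t11 gerDl; move: h1; rewrite t11 gerDl hs pmulr_lle0//.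
apply: (@holder_of_scales R (fun h => 0 <= t + h <= 1)
  (fun h => `|v (t + h) - v t|) theta eta a (d%:R * C * D + D)) => //.
- by rewrite th0.
- by rewrite addr_ge0// !mulr_ge0.
- by rewrite addr0 subrr normr0.
- by move=> h th; rewrite (le_trans (DP _ _ _ _))// lerDr !mulr_ge0.
move=> n h th hn; have y01 := etaP n h hn th.
have -> : theta `^ a = q.
  by rewrite /q /theta exprn_powR// half_powR.
have -> : t + h = zoom (W n) (t + h / theta ^+ n).
  have := zoom_diff (W n) (t + h / theta ^+ n) t.
  have e : t + h / theta ^+ n - t = h / theta ^+ n by rewrite addrAC subrr add0r.
  rewrite Wfix Wsize e divfK ?gt_eqF ?exprn_gt0// => /eqP.
  by rewrite subr_eq => /eqP ->; rewrite addrC.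
rewrite -{2}(Wfix n) curve_zoom// (le_trans (WC _ _ _ _ _))//.
by rewrite ler_wpM2r ?exprn_ge0// lerDl.
Qed.

(** The two halves of the curve meet at [v (1/2)], so [x = v 1 - v 0] satisfies [A_0 x + A_1 x = x].
    Hence the mean of [A_w x] over the words of length [n] is [2^(-n) x], too large for a rate below
    1/2. *)
Lemma growth_ge_half q : 0 < q -> growth A q -> 2^-1 <= q.
Proof.
move=> q0 [C CP].
have C0 : 0 <= C by have := CP [::]; rewrite expr0 mulr1; apply: le_trans.
pose x := v 1 - v 0.
have h0 : ((true : nat)%:R + 0) / 2 = 2^-1 :> R by rewrite /=; field.
have h1 : ((false : nat)%:R + 1) / 2 = 2^-1 :> R by rewrite /=; field.
have xA : A false *m x + A true *m x = x.
  have := curve_zoom [:: false] i1 i0; have := curve_zoom [:: true] i1 i0.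
  rewrite /= !mulmx1 => <- <-; rewrite h0 (h1 : (0 + 1) / 2 = _) add0r mul0r.
  by rewrite -[1 + 1]/2 divff// addrC addrA subrK.
(* If the ends coincided, [v 0] would be fixed by both maps, an invariant plane of dimension 0. *)
have x0 : x != 0.
  apply/eqP => /subr0_eq v10; apply: Birr; exists (v 0), 0%VS; rewrite dimv0; split=> //.
  move=> k y; rewrite !memv0 !subr_eq0 => /eqP ->.
  rewrite -curve_half//; case: k; last by rewrite add0r mul0r.
  by rewrite h0 -h1 curve_half// v10 -curve_half// add0r mul0r.
have avgx n : avg n (fun w => wprod A w *m x) = 2^-1 ^+ n *: x.
  elim: n => [|n IH] /=; first by rewrite mul1mx expr0 scale1r.
  have avgD (V : lmodType R) k (f g : seq bool -> V) :
      avg k f + avg k g = avg k (fun w => f w + g w).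
    by elim: k f g => //= k IHk f g; rewrite -scalerDr addrACA !IHk.
  rewrite avgD exprS -scalerA -IH; congr (_ *: _); apply: eq_avg => w.
  by rewrite !wprod_rcons -!mulmxA -mulmxDr xA.
rewrite leNgt; apply/negP => q2.
have xp : 0 < `|x| by rewrite normr_gt0.
have bnd n : 2^-1 ^+ n * `|x| <= d%:R * C * `|x| * q ^+ n.
  have := avg_norm n (fun w => wprod A w *m x).
  rewrite avgx normrZ ger0_norm ?exprn_ge0// => h; apply: le_trans h _.
  suff avgb k (f : seq bool -> R^o) c : (forall w, size w = k -> f w <= c) -> avg k f <= c.
    apply: avgb => w wn; rewrite (le_trans (mx_normM _ _))// [leRHS]mulrAC ler_wpM2r//.
    by rewrite -mulrA ler_wpM2l// -wn.
  elim: k f => [|k IH] f fc /=; first exact: fc.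
  have l b : avg k (fun w => f (rcons w b)) <= c.
    by apply: IH => w wk; apply: fc; rewrite size_rcons wk.
  by have := l false; have := l true; rewrite /GRing.scale /=; lra.
have K0 : 0 < d%:R * C + 1 by rewrite ltr_wpDl// mulr_ge0.
have [||N NP] := @expr_small R (2 * q) (d%:R * C + 1)^-1.
- by apply/andP; split; lra.
- by rewrite invr_gt0.
have := bnd N; rewrite mulrAC ler_pM2r// leNgt => /negP; apply.
have := NP N (leqnn _); rewrite exprMn -div1r ler_pdivlMr// => h.
have c0 := half_expr_gt0 R N; have qN : 0 < q ^+ N by rewrite exprn_gt0.
have {h} : 2^-1 ^+ N * (2 ^+ N * q ^+ N * (d%:R * C + 1)) <= 2^-1 ^+ N * 1.
  by rewrite ler_wpM2l ?(ltW c0).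
rewrite !mulrA -exprMn mulVf// expr1n mul1r mulr1; apply: lt_le_trans.
by rewrite mulrC ltr_pM2l// ltrDl.
Qed.

End Curve.

(** * The characterization *)

Section Orthogonal.
Variables (R : realType) (m : nat).

Lemma orthogonal_wprod (U : bool -> 'M[R]_m) w :
  (forall k, orthogonal_mx (U k)) -> orthogonal_mx (wprod U w).
Proof.
move=> Uo; elim: w => [|b w IH]; rewrite /orthogonal_mx /=.
  by rewrite trmx1 mulmx1.
by rewrite trmx_mul -mulmxA [_ *m (U b *m _)]mulmxA (Uo b) mul1mx IH.
Qed.

Lemma orthogonal_col (U : 'M[R]_m) j : orthogonal_mx U -> \sum_i U i j ^+ 2 = 1.
Proof.
move=> /matrixP/(_ j j); rewrite !mxE eqxx mulr1n => <-.
by apply: eq_bigr => i _; rewrite mxE expr2.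
Qed.

Lemma orthogonal_norm_le1 (U : 'M[R]_m) : orthogonal_mx U -> `|U| <= 1.
Proof.
move=> Uo; apply: mx_norm_leP => // i j.
rewrite -(ler_pXn2r (_ : 0 < 2)%N) ?nnegrE// expr1n real_normK ?num_real//.
rewrite -(orthogonal_col j Uo) (bigD1 i)//= lerDl sumr_ge0// => l _.
exact: sqr_ge0.
Qed.

Lemma orthogonal_norm_ge (U : 'M[R]_m) : (0 < m)%N -> orthogonal_mx U ->
  1 <= m%:R * `|U|.
Proof.
move=> m0 Uo; rewrite -[leLHS](orthogonal_col (Ordinal m0) Uo).
apply: (@le_trans _ _ (\sum_(i < m) `|U|)); last by rewrite sumr_const card_ord mulr_natl.
apply: ler_sum => i _; rewrite -real_normK ?num_real// expr2.
have := mx_norm_entry U i (Ordinal m0); have := orthogonal_norm_le1 Uo.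
by have := normr_ge0 (U i (Ordinal m0)); nra.
Qed.

End Orthogonal.

Lemma irreducible_scale (R : realType) m (A : bool -> 'M[R]_m) a : a != 0 ->
  mx_irreducible_pair A -> mx_irreducible_pair (fun k => a *: A k).
Proof.
move=> a0 Airr U UA; apply: Airr => k x xU.
by rewrite -[A k](scalerK a0) -scalemxAl memvZ// UA.
Qed.

Lemma growth_const (R : realType) m (X : 'M[R]_m) :
  growth (fun _ : bool => X) (m%:R * `|X|).
Proof.
exists 1; elim=> [|b w IH] /=; first by rewrite expr0 mulr1; exact: norm_mx1_le1.
by rewrite (le_trans (mx_normM _ _))// exprS mulrCA ler_wpM2l ?mulr_ge0.
Qed.

Lemma growth_compress (R : realType) m n (A : bool -> 'M[R]_m) (D : bool -> 'M[R]_n)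
    (b : 'M[R]_(m, n)) (c : 'M[R]_(n, m)) q : 0 <= q ->
  (forall w, wprod D w = c *m wprod A w *m b) -> growth A q -> growth D q.
Proof.
move=> q0 DA [C CP]; exists (m%:R * (m%:R * `|c| * C) * `|b|) => w.
rewrite DA (le_trans (mx_normM _ _))//.
rewrite [leRHS](_ : _ = m%:R * (m%:R * `|c| * (C * q ^+ size w)) * `|b|); last by ring.
rewrite ler_wpM2r// ler_wpM2l// (le_trans (mx_normM _ _))//.
by rewrite ler_wpM2l// mulr_ge0.
Qed.

(** The upper rate comes from [block_growth] at an intermediate [q1]. For the lower one, compress to
    block [j], where a product is a power of [r] times an orthogonal matrix. *)
Lemma block_form_growth (R : realType) d (M : bool -> 'M[R]_d) (r : R) :
  0 < r -> block_form M r ->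
  (forall q, r < q -> growth M q) /\
  exists2 c, 0 < c & forall w, c * r ^+ size w <= `|wprod M w|.
Proof.
move=> r0 [s [p [P [Q [[PQ QP] p0 tri irr [j [orth jsr]]]]]]].
pose b := submxrow P; pose c := submxcol Q.
have bc : \sum_i b i *m c i = 1%:M by exact: submxrow_submxcol_sum.
have cb1 i : c i *m b i = 1%:M by exact: submxcol_submxrow_diag.
have cb i j' : i != j' -> c i *m b j' = 0 by exact: submxcol_submxrow_off.
have btri k (i l : 'I_s) : (l < i)%N -> c i *m M k *m b l = 0.
  by move=> li; rewrite -submxcol_mul_submxrow; exact: tri.
have blkE i : (fun k => submxblock (Q *m M k *m P) i i) = diag_block b c M i.
  by apply/funext => k; rewrite submxcol_mul_submxrow.
have /choice[U UP] : forall k, exists U : 'M[R]_(p j),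
    orthogonal_mx U /\ diag_block b c M j k = r *: U.
  by move=> k; have [U Uo UE] := orth k; exists U; rewrite -blkE.
have Dj w : wprod (diag_block b c M j) w = r ^+ size w *: wprod U w.
  rewrite -wprod_scale; congr wprod; apply/funext => k; exact: (UP k).2.
have Uo w : orthogonal_mx (wprod U w) by apply: orthogonal_wprod => k; exact: (UP k).1.
split=> [q rq|].
  pose q1 := (r + q) / 2.
  have q10 : r < q1 by rewrite /q1; lra.
  apply: (block_growth bc btri (lt_trans r0 q10)); first by rewrite /q1; lra.
  move=> i; have [->|ij] := eqVneq i j.
    apply: (@growth_le _ _ _ r); first by rewrite !ltW.
    exists 1 => w; rewrite Dj normrZ ger0_norm ?exprn_ge0 ?(ltW r0)// mul1r.
    by rewrite ler_piMr ?exprn_ge0 ?(ltW r0)// orthogonal_norm_le1.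
  have := jsr i ij; rewrite blkE => /joint_spectral_radiusP; apply => //.
  exact: ltW.
pose K := (p j)%:R * (d%:R * (d%:R * `|c j| * `|b j|)) + 1.
have K0 : 0 < K by rewrite ltr_wpDl// !mulr_ge0.
exists K^-1; first by rewrite invr_gt0.
move=> w; rewrite ler_pdivrMl//.
have rw : 0 <= r ^+ size w by rewrite exprn_ge0// ltW.
apply: (@le_trans _ _ ((p j)%:R * `|r ^+ size w *: wprod U w|)).
  rewrite normrZ ger0_norm// mulrCA ler_peMr// orthogonal_norm_ge//.
rewrite -Dj -wprod_diag_block//.
apply: (@le_trans _ _ ((p j)%:R * (d%:R * (d%:R * `|c j| * `|wprod M w|) * `|b j|))).
  rewrite ler_wpM2l// (le_trans (mx_normM _ _))// ler_wpM2r// ler_wpM2l//.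
  exact: mx_normM.
rewrite [leLHS](_ : _ = (p j)%:R * (d%:R * (d%:R * `|c j| * `|b j|)) * `|wprod M w|).
  by rewrite ler_wpM2r// lerDl.
by ring.
Qed.

(** * From growth rates to the block form *)

Section BlockFormExists.
Variables (R : realType) (d : nat) (M : bool -> 'M[R]_d) (r : R).
Hypotheses (r0 : 0 < r) (Munit : forall k, M k \in unitmx).
Hypothesis Mgrowth : forall q, r < q -> growth M q.
Hypothesis Mper : forall w q, (0 < size w)%N -> 0 < q < r ^+ size w ->
  ~ growth (fun _ : bool => wprod M w) q.

(** [Mper] says that no product has spectral radius below [r^(size w)], powers being products of a
    constant pair. If no block can be made orthogonal, all decay in the mean, and one word violates
    [Mper]. *)
Lemma growth_block_form : block_form M r.
Proof.
have [s [p [P [Q [[PQ QP] p0 tri irr Dunit]]]]] := composition_series M.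
pose b := submxrow P; pose c := submxcol Q.
rewrite -/b -/c in tri irr Dunit.
have bc : \sum_i b i *m c i = 1%:M by exact: submxrow_submxcol_sum.
have cb1 i : c i *m b i = 1%:M by exact: submxcol_submxrow_diag.
have cb i j' : i != j' -> c i *m b j' = 0 by exact: submxcol_submxrow_off.
pose D i := diag_block b c M i.
pose A i := fun k => r^-1 *: D i k.
have rV0 : 0 < r^-1 by rewrite invr_gt0.
have Dg i q : r < q -> growth (D i) q.
  move=> rq; apply: (growth_compress (b := b i) (c := c i) _ _ (Mgrowth rq)).
    by rewrite ltW// (lt_trans r0).
  by move=> w; rewrite wprod_diag_block.
have Airr i : mx_irreducible_pair (A i).
  by apply: irreducible_scale; rewrite ?gt_eqF//; exact: irr.
have Aunit i k : A i k \in unitmx.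
  by rewrite /A -mul_scalar_mx unitmx_mul Dunit// andbT -scalemx1 unitmxZ ?unitmx1// unitfE gt_eqF.
have Abnd i : exists C, forall w, `|wprod (A i) w| <= C.
  apply: irreducible_bounded (Airr i) _ => q q1.
  rewrite -[q](mulKf (lt0r_neq0 r0)); apply: growth_scale => //; apply: Dg.
  by rewrite ltr_pMr.
pose ortho i (S : 'M[R]_(p i)) :=
  S \in unitmx /\ forall k, orthogonal_mx (mx_conj (A i) S k).
have [[j [Sj Sjo]]|northo] := pselect (exists j S, ortho j S).
  (* Only the blocks that can be made orthogonal change their basis. *)
  pose S i : 'M[R]_(p i) :=
    if pselect (exists S, ortho i S) is left e then projT1 (cid e) else 1%:M.
  have Sunit i : S i \in unitmx.
    by rewrite /S; case: pselect => [e|_]; [case: (projT2 (cid e))|exact: unitmx1].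
  have Sj_ortho : ortho j (S j).
    rewrite /S; case: pselect => [e|]; first exact: projT2 (cid e).
    by case; exists Sj.
  pose b' i := b i *m S i; pose c' i := invmx (S i) *m c i.
  have blkE k i l : submxblock ((\mxcol_i c' i) *m M k *m (\mxrow_i b' i)) i l =
      invmx (S i) *m (c i *m M k *m b l) *m S l.
    by rewrite submxcol_mul_submxrow mxcolK mxrowK /c' /b' !mulmxA.
  have P'Q' : (\mxrow_i b' i) *m (\mxcol_i c' i) = 1%:M.
    rewrite mul_mxrow_mxcol -bc; apply: eq_bigr => i _.
    by rewrite /b' /c' -mulmxA mulKVmx.
  have dE : (\sum_(i < s) p i)%N = d.
    apply/eqP; rewrite eqn_leq; apply/andP; split.
      rewrite -[X in (X <= _)%N](mxrank1 R) -QP.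
      exact: leq_trans (mxrankM_maxr _ _) (rank_leq_row _).
    rewrite -[X in (X <= _)%N](mxrank1 R) -PQ.
    exact: leq_trans (mxrankM_maxr _ _) (rank_leq_row _).
  have conjE i : (fun k => submxblock ((\mxcol_i c' i) *m M k *m (\mxrow_i b' i)) i i) =
      mx_conj (D i) (S i).
    by apply/funext => k; rewrite blkE.
  exists s, p, (\mxrow_i b' i), (\mxcol_i c' i); split=> //.
  - by split=> //; exact: mulmx1_swap P'Q'.
  - by move=> k i l li; rewrite blkE tri// mulmx0 mul0mx.
  - by move=> i; rewrite conjE; apply: irreducible_conj => //; exact: irr.
  - exists j; split=> [k|i ij].
      exists (mx_conj (A j) (S j) k); first exact: Sj_ortho.2.
      rewrite blkE /mx_conj /A -scalemxAr -scalemxAl scalerA mulfV ?gt_eqF// scale1r.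
      by [].
    rewrite conjE; apply/joint_spectral_radiusP => //; first exact: ltW.
    move=> q rq; apply: (growth_compress (b := S i) (c := invmx (S i)) _ _ (Dg i q rq)).
      by rewrite ltW// (lt_trans r0).
    by move=> w; rewrite wprod_conj.
exfalso.
have decay i : forall e : R, 0 < e -> exists N, forall n, (N <= n)%N ->
    avg n (fun w => `|wprod (A i) w| ^+ 2 : R^o) <= e.
  have [C CP] := Abnd i.
  have [//|[S Su So]] := decay_or_orthogonal (p0 i) (Airr i) (Aunit i) CP.
  by exfalso; apply: northo; exists i, S.
(* [T] exceeds every block size, so [p i * e <= 1/4]. *)
pose T : R := (\sum_(i < s) p i)%N%:R + 1.
have T0 : 0 < T by rewrite ltr_wpDl.
pose e := (4 * T)^-1; have e0 : 0 < e by rewrite invr_gt0 mulr_gt0.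
(* The share of each of the [s] blocks in a total of [e^2]; [s.+1] avoids a zero denominator. *)
have es0 : 0 < e ^+ 2 / s.+1%:R by rewrite divr_gt0// exprn_gt0.
have /choice[N NP] := fun i => decay i _ es0.
(* The successor makes the word nonempty, as [Mper] requires. *)
pose n := (\max_i N i).+1.
have [w wn wP] := avg_exists n (fun w => \sum_i `|wprod (A i) w| ^+ 2 : R^o).
have {}wP : \sum_i `|wprod (A i) w| ^+ 2 <= e ^+ 2.
  apply: le_trans wP _; rewrite avg_sum.
  apply: (@le_trans _ _ (\sum_(i < s) e ^+ 2 / s.+1%:R)).
    by apply: ler_sum => i _; apply: NP; rewrite leqW// leq_bigmax.
  rewrite sumr_const card_ord -[leLHS]mulr_natl mulrCA ler_piMr ?sqr_ge0//.
  by rewrite ler_pdivrMr// mul1r ler_nat.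
have wA i : `|wprod (A i) w| <= e.
  rewrite -(ler_pXn2r (_ : 0 < 2)%N) ?nnegrE ?(ltW e0)//; apply: le_trans wP.
  by rewrite (bigD1 i)//= lerDl sumr_ge0// => l _; rewrite exprn_ge0.
have rn0 : 0 < r ^+ n by rewrite exprn_gt0.
have wD i : (p i)%:R * `|wprod (D i) w| <= r ^+ n / 2.
  have -> : wprod (D i) w = r ^+ n *: wprod (A i) w.
    rewrite -wn -wprod_scale; congr wprod; apply/funext => k.
    by rewrite /A scalerA mulfV ?gt_eqF// scale1r.
  rewrite normrZ ger0_norm ?(ltW rn0)// mulrCA ler_wpM2l ?(ltW rn0)//.
  apply: (@le_trans _ _ (T * e)).
    rewrite ler_pM//; last exact: wA.
    by rewrite /T (bigD1 i)//= natrD -addrA lerDl addr_ge0.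
  rewrite /e invfM mulrCA mulfV ?gt_eqF// mulr1; lra.
have wtri (k : bool) (i l : 'I_s) : (l < i)%N -> c i *m wprod M w *m b l = 0.
  exact: wprod_tri.
(* Powers of this product have rate at most [r^n / 2] in every block, hence rate [3/4 r^n]
   overall. *)
apply: (Mper (w := w) (q := 3 / 4 * r ^+ n)); rewrite ?wn//.
  by apply/andP; split; lra.
have q0 : 0 < r ^+ n / 2 by rewrite divr_gt0.
apply: (block_growth bc wtri q0); first lra.
move=> i; apply: growth_le (growth_const _); rewrite mulr_ge0//= /diag_block.
by rewrite wprod_diag_block.
Qed.

End BlockFormExists.

Lemma pow2_log (R : realType) (x : R) : 0 < x -> 2 `^ (ln x / ln 2) = x.
Proof.
move=> x0; have l2 : ln 2 != 0 :> R by rewrite gt_eqF// ln_gt0// ltr1n.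
by rewrite /powR pnatr_eq0 /= divfK// lnK.
Qed.

(** * Exponents of the curve *)

Section Exponent.
Variables (R : realType) (d : nat) (B : bool -> affine_op R d) (v : R -> 'cV[R]_d).
Hypotheses (d0 : (0 < d)%N) (Birr : affine_irreducible B) (Bv : fractal_curve B v).

Let A k := linear_part (B k).

Lemma holder_exponent_ge t a : holder_at v t a -> (a%:E <= holder_exponent v t)%E.
Proof. by move=> h; apply: ereal_sup_ubound; exists a. Qed.

Lemma holder_exponent_gt t a : (a%:E < holder_exponent v t)%E ->
  exists2 a', a < a' & holder_at v t a'.
Proof. by move=> /ereal_sup_gt[_ [a' ha' <-]]; rewrite lte_fin => aa'; exists a'. Qed.

(** An exponent above [al] would make the products along the digits of [t] decay faster than
    [c r^n]; growth at all rates above [r] yields every positive exponent below [al]. *)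
Lemma holder_exponentE (r : R) : 0 < r < 1 -> (forall q, r < q -> growth A q) ->
  (exists2 c, 0 < c & forall w, c * r ^+ size w <= `|wprod A w|) ->
  forall t, 0 <= t <= 1 -> holder_exponent v t = (- (ln r / ln 2))%:E.
Proof.
move=> /andP[r0 r1] rg [c c0 cP] t t01; set al := - (ln r / ln 2).
have rE : 2 `^ (- al) = r by rewrite opprK pow2_log.
have al0 : 0 < al by rewrite -[al]opprK oppr_gt0 -ltr_pow2 powRr0 rE.
apply/eqP; rewrite eq_le; apply/andP; split.
  apply: ub_ereal_sup => _ [a ha <-]; rewrite lee_fin leNgt; apply/negP => ala.
  have [C C0 CP] := holder_prefix Birr Bv ha.
  pose x := 2 `^ (- a) / r.
  have x01 : 0 <= x < 1.
    rewrite /x divr_ge0 ?powR_ge0 ?(ltW r0)//= ltr_pdivrMr// mul1r -rE.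
    by rewrite ltr_pow2 ltrN2.
  have K0 : 0 < C + 1 by rewrite ltr_wpDl.
  have [|N NP] := expr_small x01 (_ : 0 < c / (C + 1) / 2); first by rewrite !divr_gt0.
  have [w [s [wN s01 tE]]] := zoom_exists N t01.
  have := le_trans (cP w) (CP w s s01 tE); rewrite wN.
  have -> : 2 `^ (- a) = x * r by rewrite divfK// gt_eqF.
  rewrite exprMn mulrA ler_pM2r ?exprn_gt0// => h.
  have := NP N (leqnn _); rewrite ler_pdivlMr// ler_pdivlMr// => h2.
  have xN : 0 <= x ^+ N by rewrite exprn_ge0//; case/andP: x01.
  by nra.
(* The maximum with [al / 2] keeps the tested exponent positive. *)
apply/lee_subgt0Pr => e e0; pose a := Num.max (al - e) (al / 2).
apply: (@le_trans _ _ a%:E); first by rewrite -EFinB lee_fin le_max lexx.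
apply: holder_exponent_ge.
have a0 : 0 < a by rewrite lt_max divr_gt0// orbT.
apply: (growth_holder Bv) => //; apply: rg.
rewrite -rE ltr_pow2 ltrN2 gt_max; apply/andP; split; lra.
Qed.

(** The common exponent is positive by [growth_lt1] and at most 1 by [growth_ge_half], so
    [r = 2^(-al)] is in range. A product with too small a rate would give a periodic point of larger
    exponent. *)
Lemma constant_regularity_growth : constant_local_regularity v ->
  exists r : R, [/\ 2^-1 <= r < 1, forall q, r < q -> growth A q &
    forall w q, (0 < size w)%N -> 0 < q < r ^+ size w ->
      ~ growth (fun _ : bool => wprod A w) q].
Proof.
move=> cst; pose E := holder_exponent v 0.
have i0 : 0 <= (0 : R) <= 1 by rewrite lexx ler01.
have EE t : 0 <= t <= 1 -> holder_exponent v t = E by move=> t01; exact: cst.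
have up a : 0 < a -> (a%:E < E)%E -> growth A (2 `^ (- a)).
  move=> a0 aE; apply: (holder_growth d0 Birr Bv) => // t t01.
  by apply: holder_exponent_gt; rewrite EE.
have up1 a : 0 < a -> (a%:E < E)%E -> a <= 1.
  move=> a0 aE; have : 2^-1 <= 2 `^ (- a) :> R.
    by apply: (growth_ge_half d0 Birr Bv) (up a a0 aE); rewrite powR_gt0.
  by rewrite -[2^-1]powR_inv1// ler_pow2 lerN2.
have [q /andP[q0 q1] qg] := growth_lt1 d0 Birr Bv.
pose a0 := - (ln q / ln 2).
have qE : 2 `^ (- a0) = q by rewrite opprK pow2_log.
have a00 : 0 < a0 by rewrite -[a0]opprK oppr_gt0 -ltr_pow2 powRr0 qE.
have a0E : (a0%:E <= E)%E.
  apply: holder_exponent_ge; apply: (growth_holder Bv) => //.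
  by rewrite qE.
have [al EA] : exists al, E = al%:E.
  move: a0E up1; rewrite /E; case: (holder_exponent v 0) => [al _ _|_ up1|//].
    by exists al.
  by have := up1 2 ltac:(by []) (ltry _); lra.
have al0 : 0 < al by apply: lt_le_trans a00 _; rewrite -lee_fin -EA.
have al1 : al <= 1.
  rewrite leNgt; apply/negP => al1; have := up1 ((1 + al) / 2).
  rewrite EA lte_fin => h; have : (1 + al) / 2 <= 1 by apply: h; lra.
  by lra.
exists (2 `^ (- al)); split.
- rewrite -[2^-1]powR_inv1// ler_pow2 lerN2 al1 /=.
  by rewrite -[ltRHS](powRr0 2) ltr_pow2 oppr_lt0.
- move=> q' rq'; have q'0 : 0 < q' by apply: lt_trans rq'; rewrite powR_gt0.
  pose a' := - (ln q' / ln 2).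
  have q'E : 2 `^ (- a') = q' by rewrite opprK pow2_log.
  have a'al : a' < al by rewrite -ltrN2 -ltr_pow2 q'E.
  pose a := Num.max a' (al / 2).
  have aa : 0 < a by rewrite lt_max divr_gt0// orbT.
  apply: (growth_le (x := 2 `^ (- a))).
    by rewrite powR_ge0 -q'E ler_pow2 lerN2 le_max lexx.
  by apply: up => //; rewrite EA lte_fin gt_max a'al /=; lra.
- move=> w q' w0 /andP[q'0 q'r] wg.
  have n0 : 0 < (size w)%:R :> R by rewrite ltr0n.
  (* The exponent with [2^(-a size w) = q']; it exceeds [al] because [q' < r^(size w)]. *)
  pose a := - (ln q' / ln 2) / (size w)%:R.
  have aE : (2 `^ (- a)) ^+ size w = q'.
    rewrite -powR_mulrn ?powR_ge0// -powRrM mulNr divfK ?gt_eqF//.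
    by rewrite opprK pow2_log.
  have ala : al < a.
    rewrite ltNge; apply/negP => aal; move: q'r; rewrite -aE ltNge => /negP; apply.
    by rewrite lerXn2r ?nnegrE ?powR_ge0// ler_pow2 lerN2.
  have [||t t01 ht] := periodic_holder (a := a) Bv w0.
  + exact: lt_trans ala.
  + by rewrite aE.
  have := holder_exponent_ge ht; rewrite EE// EA lee_fin leNgt ala.
  by [].
Qed.

End Exponent.

Theorem theorem12 (R : realType) (d : nat) (B : bool -> affine_op R d)
    (v : R -> 'cV[R]_d) :
  (0 < d)%N ->
  common_contractions B ->
  (forall k, nonsingular (B k)) ->
  affine_irreducible B ->
  barnsley B ->
  fractal_curve B v ->
  (constant_local_regularity v <->
     exists2 r : R, 2^-1 <= r < 1 & block_form (fun k => linear_part (B k)) r)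
  /\
  (forall r : R, 2^-1 <= r < 1 ->
     block_form (fun k => linear_part (B k)) r ->
     forall t : R, 0 <= t <= 1 ->
       holder_exponent v t = (- (ln r / ln 2))%:E).
Proof.
move=> d0 _ Bns Birr _ Bv.
have expE (r : R) : 2^-1 <= r < 1 -> block_form (fun k => linear_part (B k)) r ->
    forall t : R, 0 <= t <= 1 -> holder_exponent v t = (- (ln r / ln 2))%:E.
  move=> /andP[r2 r1] bf; have r0 : 0 < r by apply: lt_le_trans r2.
  have [rg rl] := block_form_growth r0 bf.
  by apply: (holder_exponentE Birr Bv) => //; rewrite r0.
split=> //; split=> [cst|[r r01 bf] t s t01 s01]; last by rewrite !(expE r).
have [r [r01 rg rper]] := constant_regularity_growth d0 Birr Bv cst.
exists r => //; apply: growth_block_form => //.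
by case/andP: r01 => r2 _; apply: lt_le_trans r2.
Qed.
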